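(* (1) Let $(V=S(U),\Delta)$ be a pure $BV_\infty$-algebra. Then the restriction to $U[1]\subset S(U)[1]$ of the higher derived brackets $l_n(a_1,\dots,a_n)=[[\dots[\Delta_n,L_{a_1}],\dots],L_{a_n}]1$, $n\ge1$, provides $U[1]$ with the structure of an $L_\infty$-subalgebra of the $L_\infty$-algebra $S(U)[1]$. (2) The original pure $BV_\infty$-structure on $S(U)$ coincides with the $BV_\infty$-structure $\frac1\hbar\sum_{n\ge1}\hbar^nD_n$ associated with the derived $L_\infty$-structure on $U[1]$ of part (1), where $D_n$ is the coderivation extending $l_n|_{S^n(U[2])}:S^n(U[2])\to U[2]$. (3) If one starts with an $L_\infty$-structure on a graded vector space $U[1]$ and constructs the associated $BV_\infty$-algebra $S(U)$ with $\Delta=\frac1\hbar\sum_{n\ge1}\hbar^nD_n$, then the derived brackets $l_n$ of this $BV_\infty$-algebra, restricted to $U[1]\subset S(U)[1]$, return the original $L_\infty$-structure on $U[1]$.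
   Context: Conventions. $k$ is a field of characteristic zero; everything is $\mathbb Z$-graded over $k$ with the Koszul sign rule. $V[n]^p:=V^{n+p}$. $\hbar$ is a formal variable of degree $2$, and $V[[\hbar]]$ is the graded $k[[\hbar]]$-module of formal power series in $\hbar$ with values in $V$ (graded by total degree). Graded commutative algebras are unital. $L_\infty$-algebras. $S(\mathfrak g[1])$ is the cofree cocommutative coalgebra with the shuffle comultiplication. An $L_\infty$-structure on a graded vector space $\mathfrak g$ is a coderivation $D$ of $S(\mathfrak g[1])$ of degree one with $D^2=0$, $D(1)=0$. Write $D=D_1+D_2+\dots$, where $D_n$ is the coderivation extending the component $l_n:S^n(\mathfrak g[1])\to\mathfrak g[1]$ (the $n$-th bracket) of $D$: for $m\ge n$, $$D_n(x_1\cdots x_m)=\sum_{\sigma\in \mathrm{Sh}_{n,m-n}}(-1)^{|x_\sigma|}l_n(x_{\sigma(1)},\dots,x_{\sigma(n)})\,x_{\sigma(n+1)}\cdots x_{\sigma(m)},$$ and $D_n=0$ on $S^m$ for $m<n$ ($\mathrm{Sh}_{n,m-n}$: $(n,m-n)$-shuffles; $(-1)^{|x_\sigma|}$: Koszul sign). An $L_\infty$-subalgebra is a graded subspace closed under all brackets $l_n$, with the restricted brackets. $BV_\infty$-algebras. A linear operator $D$ on a graded commutative algebra $V$ is a differential operator of order $\le n$ if $[[\dots[D,L_{a_0}],\dots],L_{a_n}]=0$ for all $a_0,\dots,a_n\in V$, where $L_a(b)=ab$ and brackets are graded commutators. A $BV_\infty$-algebra is a graded commutative algebra $V$ with a $k$-linear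 degree-one map $\Delta=\frac1\hbar\sum_{n\ge1}\hbar^n\Delta_n:V\to V[[\hbar]]$, $\Delta_n$ a differential operator of order $\le n$ on $V$, such that $\Delta^2=0$ (after continuous $k[[\hbar]]$-linear extension to $V[[\hbar]]$) and $\Delta(1)=0$. A pure $BV_\infty$-algebra is a free graded commutative algebra $S(U)$ on a graded vector space $U$ with a $BV_\infty$ operator $\Delta$ such that, for each $n\ge1$, $\Delta_n$ maps $S^n(U)$ to $U$ and $S^{<n}(U)$ to $0$. Known constructions. (a) For any $BV_\infty$-algebra $V$, the brackets $l_n(a_1,\dots,a_n)=[[\dots[\Delta_n,L_{a_1}],\dots],L_{a_n}]1$, viewed as degree-one maps $S^n(V[2])\to V[2]$, define an $L_\infty$-structure on $V[1]$ (T. Voronov). (b) For any $L_\infty$-algebra $\mathfrak g$, the algebra $S(\mathfrak g[-1])$ is a $BV_\infty$-algebra with $\Delta=\frac1\hbar\sum_{n\ge1}\hbar^nD_n$, where $S^m(\mathfrak g[1])$ and $S^m(\mathfrak g[-1])$ are identified by the $m$-fold double suspension (degree shift by $2m$, no signs) (Braun-Lazarev). For $\mathfrak g=U[1]$ one has $\mathfrak g[-1]=U$. *)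

(* Defs.v *)
From HB Require Import structures.
From mathcomp Require Import all_boot all_order all_algebra perm.
From mathcomp Require Import ring.
From mathcomp Require Import boolp.

Set Implicit Arguments.
Unset Strict Implicit.
Unset Printing Implicit Defensive.

Import Order.TTheory GRing.Theory Num.Theory.
Local Open Scope ring_scope.
Local Open Scope quotient_scope.

Section LinearFacts.
Variables (k : fieldType) (A B : lmodType k) (g : A -> B).
Hypothesis lg : linear g.
Lemma lin0 : g 0 = 0.
Proof. by have := lg (-1) 0 0; rewrite !scaleN1r !addNr. Qed.
Lemma linD x y : g (x + y) = g x + g y.
Proof. by have := lg 1 x y; rewrite !scale1r. Qed.
Lemma linZ c x : g (c *: x) = c *: g x.
Proof. by have := lg c x 0; rewrite lin0 !addr0. Qed.
Lemma lin_sum I (r : seq I) (P : pred I) (F : I -> A) :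
  g (\sum_(i <- r | P i) F i) = \sum_(i <- r | P i) g (F i).
Proof. exact: (big_morph _ linD lin0). Qed.
Lemma lin_comp (C : lmodType k) (f : B -> C) :
  linear f -> linear (fun x => f (g x)).
Proof. by move=> lf c x y; rewrite lg lf. Qed.
End LinearFacts.

(* The universal k-module receiving maps out of G with property P: formal
   combinations of elements of G, two of them being identified when no map with
   property P distinguishes them. Only properties P that are defined by linear
   equations are used; then ugen satisfies P and ulift, umod_ext give the
   universal property. *)
Section UniversalModule.
Variables (k : fieldType) (G : Type).
Variable P : forall M : lmodType k, (G -> M) -> Prop.

Definition fsum := seq (k * G).
HB.instance Definition _ := gen_eqMixin fsum.
HB.instance Definition _ := gen_choiceMixin fsum.

Definition feval (M : lmodType k) (f : G -> M) (s : fsum) : M :=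
  \sum_(t <- s) t.1 *: f t.2.

Definition fequiv (s t : fsum) : bool :=
  `[< forall (M : lmodType k) (f : G -> M), P f -> feval f s = feval f t >].

Lemma fequiv_refl : reflexive fequiv.
Proof. by move=> s; apply/asboolP. Qed.
Lemma fequiv_sym : symmetric fequiv.
Proof. by move=> s t; apply/asboolP/asboolP => h M f Pf; rewrite h. Qed.
Lemma fequiv_trans : transitive fequiv.
Proof.
by move=> t s r /asboolP h1 /asboolP h2; apply/asboolP => M f Pf; rewrite h1 ?h2.
Qed.
Canonical fequiv_rel := EquivRel fequiv fequiv_refl fequiv_sym fequiv_trans.

Definition umod := {eq_quot fequiv_rel}.
HB.instance Definition _ := Choice.on umod.
HB.instance Definition _ := EqQuotient.on umod.

Definition ulift (M : lmodType k) (f : G -> M) (x : umod) : M :=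
  feval f (repr x).

Lemma feval_repr (M : lmodType k) (f : G -> M) s :
  P f -> ulift f (\pi_umod s) = feval f s.
Proof.
move=> Pf; rewrite /ulift.
have /eqmodP/asboolP -> // : repr (\pi_umod s) = s %[mod umod] by rewrite reprK.
Qed.

Lemma umod_eq (x y : umod) :
  (forall (M : lmodType k) (f : G -> M), P f -> ulift f x = ulift f y) -> x = y.
Proof.
move=> h; rewrite -[x]reprK -[y]reprK; apply/eqmodP/asboolP => M f Pf.
exact: h.
Qed.

Definition fscale (c : k) (s : fsum) : fsum := [seq (c * t.1, t.2) | t <- s].
Definition uzero : umod := \pi_umod [::].
Definition uadd (x y : umod) : umod := \pi_umod (repr x ++ repr y).
Definition uscale c (x : umod) : umod := \pi_umod (fscale c (repr x)).

Lemma ulift0 (M : lmodType k) (f : G -> M) : P f -> ulift f uzero = 0.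
Proof. by move=> Pf; rewrite feval_repr // /feval big_nil. Qed.
Lemma uliftD (M : lmodType k) (f : G -> M) x y :
  P f -> ulift f (uadd x y) = ulift f x + ulift f y.
Proof. by move=> Pf; rewrite feval_repr // /feval big_cat. Qed.
Lemma uliftZ (M : lmodType k) (f : G -> M) c x :
  P f -> ulift f (uscale c x) = c *: ulift f x.
Proof.
move=> Pf; rewrite feval_repr // /ulift /feval big_map scaler_sumr.
by apply: eq_bigr => t _; rewrite scalerA.
Qed.

Let ulE := (ulift0, uliftD, uliftZ).
Ltac by_lift := move=> *; apply: umod_eq => M f Pf; rewrite !ulE //.

Lemma uaddA : associative uadd. Proof. by by_lift; rewrite addrA. Qed.
Lemma uaddC : commutative uadd. Proof. by by_lift; rewrite addrC. Qed.
Lemma uadd0 : left_id uzero uadd. Proof. by by_lift; rewrite add0r. Qed.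
Lemma uaddN : left_inverse uzero (uscale (-1)) uadd.
Proof. by by_lift; rewrite scaleN1r addNr. Qed.
HB.instance Definition _ := GRing.isZmodule.Build umod uaddA uaddC uadd0 uaddN.

Lemma uscaleA a b x : uscale a (uscale b x) = uscale (a * b) x.
Proof. by by_lift; rewrite scalerA. Qed.
Lemma uscale1 : left_id 1 uscale. Proof. by by_lift; rewrite scale1r. Qed.
Lemma uscaleDr : right_distributive uscale +%R.
Proof. by by_lift; rewrite scalerDr. Qed.
Lemma uscaleDl x : {morph uscale^~ x : a b / a + b}.
Proof. by by_lift; rewrite scalerDl. Qed.
HB.instance Definition _ :=
  GRing.Zmodule_isLmodule.Build k umod uscaleA uscale1 uscaleDr uscaleDl.

Lemma ulift_comb (M : lmodType k) (f g h : G -> M) c x :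
  (forall w, f w = c *: g w + h w) -> ulift f x = c *: ulift g x + ulift h x.
Proof.
move=> e; rewrite /ulift /feval scaler_sumr -big_split; apply: eq_bigr => t _.
by rewrite /= e scalerDr !scalerA mulrC.
Qed.

Lemma ulift_lin (M : lmodType k) (f : G -> M) : P f -> linear (ulift f).
Proof. by move=> Pf c x y; rewrite uliftD // uliftZ. Qed.

Definition ugen (g : G) : umod := \pi_umod [:: (1, g)].

Lemma ulift_gen (M : lmodType k) (f : G -> M) g : P f -> ulift f (ugen g) = f g.
Proof. by move=> Pf; rewrite feval_repr // /feval big_seq1 scale1r. Qed.

Lemma umodE x : exists s : fsum, x = \sum_(t <- s) t.1 *: ugen t.2.
Proof.
exists (repr x); apply: umod_eq => M f Pf.
have L : forall s, ulift f (\sum_(t <- s) t.1 *: ugen t.2) = feval f s.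
  elim=> [|t s IH]; first by rewrite big_nil ulift0 // /feval big_nil.
  by rewrite big_cons uliftD // uliftZ // ulift_gen // IH /feval big_cons.
by rewrite L.
Qed.

Lemma umod_ext (M : lmodType k) (g h : umod -> M) : linear g -> linear h ->
  (forall w, g (ugen w) = h (ugen w)) -> g =1 h.
Proof.
move=> lg lh e x; have [s ->] := umodE x.
elim: s => [|t s IH]; first by rewrite big_nil !lin0.
by rewrite big_cons lg lh IH e.
Qed.

End UniversalModule.

Section Graded.
Variable k : fieldType.

(* A grading V = \bigoplus_p V^p, given by the projections V -> V^p. *)
Record grading (V : lmodType k) := Grading {
  gcomp : int -> V -> V;
  gcomp_lin : forall p, linear (gcomp p);
  gcompK : forall p q v, gcomp p (gcomp q v) = if p == q then gcomp q v else 0;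
  gcomp_fin : forall v, exists s : seq int, uniq s /\ v = \sum_(p <- s) gcomp p v
}.

Record grspace := GrSpace { gcar :> lmodType k; gstr : grading gcar }.

Definition gproj (V : grspace) : int -> V -> V := gcomp (gstr V).
Arguments gproj : clear implicits.

Definition hmg (V : grspace) (p : int) (v : V) : Prop := gproj V p v = v.

Section Shift.
Variables (V : grspace) (n : int).

Lemma shift_compK (p q : int) (v : V) :
  gproj V (n + p) (gproj V (n + q) v) = if p == q then gproj V (n + q) v else 0.
Proof. by rewrite /gproj gcompK (inj_eq (addrI n)). Qed.
Lemma shift_fin (v : V) :
  exists s : seq int, uniq s /\ v = \sum_(p <- s) gproj V (n + p) v.
Proof.
have [s [us {1}->]] := gcomp_fin (gstr V) v.
exists [seq p - n | p <- s]; split.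
  by rewrite map_inj_uniq //; apply: addIr.
by rewrite big_map; apply: eq_bigr => p _; rewrite addrC subrK.
Qed.

Definition shift : grspace := GrSpace
  (Grading (fun p => gcomp_lin (gstr V) (n + p)) shift_compK shift_fin).
End Shift.

Section Support.
Variables (V : grspace).

Lemma gprojP p : linear (gproj V p).
Proof. exact: gcomp_lin. Qed.
Lemma gprojK p q v :
  gproj V p (gproj V q v) = if p == q then gproj V q v else 0.
Proof. exact: gcompK. Qed.
Lemma gproj0 p : gproj V p (0 : V) = 0.
Proof. exact: lin0 (gprojP p). Qed.
Lemma gprojD p (u v : V) : gproj V p (u + v) = gproj V p u + gproj V p v.
Proof. exact: linD (gprojP p) _ _. Qed.
Lemma gprojZ p c (u : V) : gproj V p (c *: u) = c *: gproj V p u.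
Proof. exact: linZ (gprojP p) _ _. Qed.
Lemma gproj_sum p I (r : seq I) (F : I -> V) :
  gproj V p (\sum_(i <- r) F i) = \sum_(i <- r) gproj V p (F i).
Proof. by apply: (big_morph _ (gprojD p) (gproj0 p)). Qed.

Definition gsupp (v : V) : seq int := projT1 (cid (gcomp_fin (gstr V) v)).
Lemma gsupp_uniq v : uniq (gsupp v).
Proof. by rewrite /gsupp; case: cid => s []. Qed.
Lemma gsuppE v : v = \sum_(p <- gsupp v) gproj V p v.
Proof. by rewrite /gsupp; case: cid => s []. Qed.
Lemma gsupp_out v p : p \notin gsupp v -> gproj V p v = 0.
Proof.
move=> ps; rewrite [v]gsuppE gproj_sum big_seq big1 // => q qs.
by rewrite gprojK; case: eqP => // e; rewrite e qs in ps.
Qed.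

Lemma hmg_proj p q (v : V) : hmg p v -> gproj V q v = if q == p then v else 0.
Proof. by move=> h; rewrite -h gprojK; case: eqP. Qed.

Section GSum.
Variables (M : lmodType k) (h : int -> V -> M).
Hypothesis h_lin : forall p, linear (h p).

Definition gsum (v : V) : M := \sum_(p <- gsupp v) h p (gproj V p v).

Let h0 p : h p 0 = 0. Proof. exact: lin0. Qed.

Lemma gsum_sub s v : uniq s -> {subset gsupp v <= s} ->
  gsum v = \sum_(p <- s) h p (gproj V p v).
Proof.
move=> us sub; rewrite (bigID (mem (gsupp v))) /= [X in _ = _ + X]big1 ?addr0.
  rewrite -[RHS]big_filter; apply: perm_big; apply: uniq_perm.
  - exact: gsupp_uniq.
  - exact: filter_uniq.
  by move=> p; rewrite mem_filter; case: (boolP (p \in gsupp v)) => // /sub ->.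
by move=> p /gsupp_out ->; rewrite h0.
Qed.

Lemma gsum_lin : linear gsum.
Proof.
move=> c u v.
pose s := undup (gsupp u ++ gsupp v ++ gsupp (c *: u + v)).
have us : uniq s by apply: undup_uniq.
rewrite !(gsum_sub us); first 1 last.
- by move=> p; rewrite mem_undup !mem_cat => ->; rewrite ?orbT.
- by move=> p; rewrite mem_undup !mem_cat => ->; rewrite ?orbT.
- by move=> p; rewrite mem_undup !mem_cat => ->; rewrite ?orbT.
rewrite scaler_sumr -big_split /=; apply: eq_bigr => p _.
by rewrite gprojP h_lin.
Qed.

Lemma gsum_hmg p v : hmg p v -> gsum v = h p v.
Proof.
move=> hv; have us : uniq (undup (p :: gsupp v)) by apply: undup_uniq.
rewrite (gsum_sub us); last by move=> q; rewrite mem_undup inE => ->; rewrite orbT.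
rewrite (bigD1_seq p) ?mem_undup ?inE ?eqxx //= (hmg_proj p hv) eqxx.
by rewrite big1 ?addr0 // => q /negbTE qp; rewrite (hmg_proj q hv) qp h0.
Qed.
End GSum.

(* The even (b = false) and odd (b = true) parts of v. *)
Definition gpar (b : bool) (v : V) : V :=
  \sum_(p <- gsupp v | odd (absz p) == b) gproj V p v.

Lemma gparE b v : gpar b v = gsum (fun p x => if odd (absz p) == b then x else 0) v.
Proof. by rewrite /gpar big_mkcond. Qed.
Lemma gpar_lin b : linear (gpar b).
Proof.
move=> c u v; rewrite !gparE; apply: gsum_lin => p d x y.
by case: ifP => // _; rewrite scaler0 addr0.
Qed.
Lemma gpar_hmg b p v : hmg p v -> gpar b v = if odd (absz p) == b then v else 0.
Proof.
move=> hv; rewrite gparE (gsum_hmg _ hv) // => q d x y.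
by case: ifP => // _; rewrite scaler0 addr0.
Qed.

End Support.

(* Unital graded commutative algebras. *)
Record gcalg := GCAlg {
  galg :> algType k;
  galg_str : grading galg;
  galg_gr := GrSpace galg_str : grspace;
  galg_1 : hmg 0 (1 : galg_gr);
  galg_M : forall (p q : int) (x y : galg), @hmg galg_gr p x -> @hmg galg_gr q y ->
    @hmg galg_gr (p + q) (x * y);
  galg_C : forall (p q : int) (x y : galg), @hmg galg_gr p x -> @hmg galg_gr q y ->
    x * y = (-1) ^+ absz (p * q) *: (y * x)
}.

End Graded.

Coercion galg_gr : gcalg >-> grspace.
Arguments gproj {k} V p v : rename.
Arguments hmg {k V} p v : rename.
Arguments gpar {k} V b v : rename.

Section Symmetric.
Variables (k : fieldType) (W : grspace k).

(* Multilinear functions of words that are symmetric with Koszul signs. *)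
Definition gsymmetric (M : lmodType k) (f : seq W -> M) : Prop :=
  (forall u v c (x y : W),
     f (u ++ (c *: x + y) :: v) = c *: f (u ++ x :: v) + f (u ++ y :: v)) /\
  (forall u v (p q : int) (x y : W), hmg p x -> hmg q y ->
     f (u ++ x :: y :: v) = (-1) ^+ absz (p * q) *: f (u ++ y :: x :: v)).

(* The free graded commutative algebra S(W); sword [:: x_1; ..; x_m] is the
   product x_1...x_m (sword_prod), and sym_free is the universal property. *)
Definition Sym := umod gsymmetric.
HB.instance Definition _ := GRing.Lmodule.on Sym.

Definition sword (w : seq W) : Sym := ugen gsymmetric w.

Definition slift (M : lmodType k) (f : seq W -> M) : Sym -> M :=
  @ulift k (seq W) gsymmetric M f.

Lemma slift_lin (M : lmodType k) (f : seq W -> M) :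
  gsymmetric f -> linear (slift f).
Proof. exact: ulift_lin. Qed.
Lemma slift_word (M : lmodType k) (f : seq W -> M) w :
  gsymmetric f -> slift f (sword w) = f w.
Proof. exact: ulift_gen. Qed.
Lemma slift_comb (M : lmodType k) (f g h : seq W -> M) c x :
  (forall w, f w = c *: g w + h w) -> slift f x = c *: slift g x + slift h x.
Proof. exact: ulift_comb. Qed.
Lemma slift_eq (M : lmodType k) (f g : seq W -> M) : f =1 g -> slift f =1 slift g.
Proof.
by move=> e x; rewrite /slift /ulift /feval; apply: eq_bigr => t _; rewrite e.
Qed.
Lemma slift_scale (M : lmodType k) (f g : seq W -> M) c x :
  (forall w, f w = c *: g w) -> slift f x = c *: slift g x.
Proof.
move=> e; rewrite /slift /ulift /feval scaler_sumr; apply: eq_bigr => t _.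
by rewrite e !scalerA mulrC.
Qed.

Lemma sword_gsym : gsymmetric sword.
Proof.
split=> [u v c x y|u v p q x y hx hy]; apply: umod_eq => M f [f1 f2].
  have Pf : gsymmetric f by split.
  apply: etrans (esym (ulift_lin Pf c (sword _) (sword _))).
  by rewrite !ulift_gen // f1.
have Pf : gsymmetric f by split.
apply: etrans (esym (uliftZ _ (sword _) Pf)).
by rewrite !ulift_gen // (f2 _ _ p q).
Qed.

Lemma sym_ext (M : lmodType k) (g h : Sym -> M) : linear g -> linear h ->
  (forall w, g (sword w) = h (sword w)) -> g =1 h.
Proof. exact: umod_ext. Qed.

Lemma gsym_pre (M : lmodType k) (f : seq W -> M) v :
  gsymmetric f -> gsymmetric (fun w => f (v ++ w)).
Proof.
case=> f1 f2; split=> [u w c x y|u w p q x y hx hy]; rewrite !catA.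
  exact: f1.
exact: f2.
Qed.
Lemma gsym_post (M : lmodType k) (f : seq W -> M) v :
  gsymmetric f -> gsymmetric (fun w => f (w ++ v)).
Proof.
case=> f1 f2; split=> [u w c x y|u w p q x y hx hy]; rewrite -!catA !cat_cons.
  exact: f1.
exact: f2.
Qed.

Definition smul (x y : Sym) : Sym :=
  slift (fun v => slift (fun w => sword (v ++ w)) y) x.

Lemma smul_gsym y : gsymmetric (fun v => slift (fun w => sword (v ++ w)) y : Sym).
Proof.
split=> [u v c x x'|u v p q x x' hx hx'].
  apply: slift_comb => w; exact: (gsym_post w sword_gsym).1.
by apply: slift_scale => w; apply: (gsym_post w sword_gsym).2.
Qed.

Lemma smul_linl y : linear (smul^~ y).
Proof. exact: slift_lin (smul_gsym y). Qed.
Lemma smul_linr x : linear (smul x).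
Proof.
move=> c y z; apply: slift_comb => v.
exact: slift_lin (gsym_pre v sword_gsym) _ _ _.
Qed.
Lemma smulE v w : smul (sword v) (sword w) = sword (v ++ w).
Proof.
rewrite /smul slift_word; last exact: smul_gsym.
by rewrite slift_word //; apply: gsym_pre sword_gsym.
Qed.

Lemma smulA : associative smul.
Proof.
move=> x y z; move: x; apply: sym_ext => [||u].
- exact: smul_linl.
- exact: (lin_comp (smul_linl y) (smul_linl z)).
move: y; apply: sym_ext => [||v].
- exact: (lin_comp (smul_linl z) (smul_linr (sword u))).
- exact: (lin_comp (smul_linr (sword u)) (smul_linl z)).
move: z; apply: sym_ext => [||w].
- exact: (lin_comp (smul_linr (sword v)) (smul_linr (sword u))).
- exact: smul_linr.
by rewrite !smulE catA.
Qed.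
Lemma smul1 : left_id (sword [::]) smul.
Proof.
apply: sym_ext => [||w]; [exact: smul_linr| by move=> ??? |by rewrite smulE].
Qed.
Lemma smulr1 : right_id (sword [::]) smul.
Proof.
by apply: sym_ext => [||w]; [exact: smul_linl| move=> ??? |rewrite smulE cats0].
Qed.
Lemma smulDl : left_distributive smul +%R.
Proof. by move=> x y z; have := smul_linl z 1 x y; rewrite /= !scale1r. Qed.
Lemma smulDr : right_distributive smul +%R.
Proof. by move=> x y z; have := smul_linr x 1 y z; rewrite !scale1r. Qed.

Definition scounit : Sym -> k^o := slift (fun w => (nilp w)%:R).
Lemma scounit_gsym : gsymmetric (fun w => (nilp w)%:R : k^o).
Proof. by split=> [[|a u] *|[|a u] *]; rewrite /= ?scaler0 ?addr0. Qed.
Lemma sone_neq0 : sword [::] != 0.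
Proof.
apply/eqP => /(congr1 scounit) h; have /eqP[] := oner_neq0 k.
move: h; rewrite [scounit 0](ulift0 scounit_gsym) /scounit slift_word //.
exact: scounit_gsym.
Qed.
HB.instance Definition _ := GRing.Zmodule_isNzRing.Build Sym
  smulA smul1 smulr1 smulDl smulDr sone_neq0.

Lemma sscaleAl c (x y : Sym) : c *: (x * y) = (c *: x) * y.
Proof. exact: esym (linZ (smul_linl y) c x). Qed.
Lemma sscaleAr c (x y : Sym) : c *: (x * y) = x * (c *: y).
Proof. exact: esym (linZ (smul_linr x) c y). Qed.
HB.instance Definition _ := GRing.Lmodule_isLalgebra.Build k Sym sscaleAl.
HB.instance Definition _ := GRing.Lalgebra_isAlgebra.Build k Sym sscaleAr.

Definition sgen (x : W) : Sym := sword [:: x].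

Lemma swordM v w : sword v * sword w = sword (v ++ w).
Proof. exact: smulE. Qed.
Lemma sword_prod w : sword w = \prod_(x <- w) sgen x.
Proof.
by elim: w => [|x w IH]; rewrite ?big_nil // big_cons -IH swordM.
Qed.
Lemma sgen_lin : linear sgen.
Proof. by move=> c x y; apply: (sword_gsym.1 [::] [::]). Qed.

End Symmetric.

Section Signs.
Variable k : fieldType.

Lemma sgzE (p : int) : (-1) ^+ absz p = (-1) ^ p :> k.
Proof. by case: p => n //; rewrite NegzE /= -exprnN invr_sign. Qed.
Lemma sgzD (p q : int) :
  (-1) ^+ absz (p + q) = (-1) ^+ absz p * (-1) ^+ absz q :> k.
Proof. by rewrite !sgzE expfzDr // oppr_eq0 oner_eq0. Qed.
Lemma sgz_shift (p q : int) :
  (-1) ^+ absz ((1 + (1 + p)) * (1 + (1 + q))) = (-1) ^+ absz (p * q) :> k.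
Proof.
have -> : (1 + (1 + p)) * (1 + (1 + q)) = p * q + (2 + p + q) + (2 + p + q) :> int.
  by ring.
by rewrite -addrA; move: (2 + p + q) => r; rewrite !sgzD -expr2 sqrr_sign mulr1.
Qed.
End Signs.

Section SymGrading.
Variables (k : fieldType) (W : grspace k).
Local Notation S := (Sym W).

Inductive hword : int -> seq W -> Prop :=
| HNil : hword 0 [::]
| HCons p q x w : hmg p x -> hword q w -> hword (p + q) (x :: w).

Lemma hword_cat p q v w : hword p v -> hword q w -> hword (p + q) (v ++ w).
Proof.
elim=> [|p1 p2 x u hx hu IH] hw; first by rewrite add0r.
by rewrite -addrA; apply: HCons => //; apply: IH.
Qed.

Lemma sword_suml u v s (x : W) :
  x = \sum_(p <- s) gproj W p x ->
  sword (u ++ x :: v) = \sum_(p <- s) sword (u ++ gproj W p x :: v).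
Proof.
move=> {1}->.
have L : linear (fun y => sword (u ++ y :: v)).
  by move=> c y z; apply: (sword_gsym W).1.
exact: (lin_sum L).
Qed.

Lemma sym_hind (Q : S -> Prop) :
  Q 0 -> (forall c x y, Q x -> Q y -> Q (c *: x + y)) ->
  (forall p w, hword p w -> Q (sword w)) -> forall x, Q x.
Proof.
move=> Q0 QD Qw.
have Qsum I (r : seq I) (F : I -> S) :
  (forall i, Q (F i)) -> Q (\sum_(i <- r) F i).
  move=> QF; elim: r => [|i r IH]; rewrite ?big_nil ?big_cons //.
  by rewrite -[F i]scale1r; apply: QD.
have Qa : forall w, Q (sword w).
  move=> w; suff H : forall p u, hword p u -> Q (sword (u ++ w)).
    by apply: (H 0 [::]); apply: HNil.
  elim: w => [|x w IH] p u hu; first by rewrite cats0; apply: Qw hu.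
  rewrite (sword_suml u w (gsuppE x)); apply: Qsum => q.
  rewrite -cat_rcons; apply: (IH (p + (q + 0))); rewrite -cats1.
  apply: hword_cat => //; apply: HCons HNil; by rewrite /hmg gprojK eqxx.
move=> x; have [s ->] := umodE x; apply: Qsum => t.
rewrite -[_ *: _]addr0; apply: QD => //; apply: Qa.
Qed.

Lemma sym_hext (M : lmodType k) (g h : S -> M) : linear g -> linear h ->
  (forall p w, hword p w -> g (sword w) = h (sword w)) -> g =1 h.
Proof.
move=> lg lh e; apply: sym_hind => [|c x y ex ey|]; rewrite ?lin0 //.
by rewrite lg lh ex ey.
Qed.

Fixpoint wcomp (w : seq W) (p : int) : S :=
  if w is x :: w' then gsum (fun q y => sgen y * wcomp w' (p - q)) x
  else if p == 0 then 1 else 0.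

Lemma wcomp_lin w (p q : int) :
  linear (fun y => sgen y * wcomp w (p - q) : S).
Proof. by move=> c x y; rewrite sgen_lin mulrDl scalerAl. Qed.

Lemma wcomp_gsym p : gsymmetric (fun w => wcomp w p).
Proof.
split=> [u v c x y|u v d e x y hx hy].
  elim: u p => [|z u IH] p /=; first by apply: gsum_lin => q; apply: wcomp_lin.
  rewrite /gsum scaler_sumr -big_split /=; apply: eq_bigr => q _.
  by rewrite IH mulrDr scalerAr.
elim: u p => [|z u IH] p /=.
  rewrite (gsum_hmg _ hx); last by move=> q; apply: (wcomp_lin (y :: v)).
  rewrite (gsum_hmg _ hy); last by move=> q; apply: wcomp_lin.
  rewrite (gsum_hmg _ hy); last by move=> q; apply: (wcomp_lin (x :: v)).
  rewrite (gsum_hmg _ hx); last by move=> q; apply: wcomp_lin.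
  rewrite !mulrA scalerAl addrAC; congr (_ * _).
  by rewrite !swordM /= -((sword_gsym W).2 [::] [::] _ _ _ _ hx hy).
rewrite /gsum scaler_sumr; apply: eq_bigr => q _.
by rewrite IH scalerAr.
Qed.

Definition scomp (p : int) : S -> S := slift (fun w => wcomp w p).

Lemma scomp_lin p : linear (scomp p).
Proof. exact: slift_lin (wcomp_gsym p). Qed.

Lemma scomp_hword p q w :
  hword q w -> scomp p (sword w) = if p == q then sword w else 0.
Proof.
rewrite /scomp slift_word; last exact: wcomp_gsym.
move=> hw; elim: hw p => {q w} [|d q x w hx hw IH] p //=.
rewrite (gsum_hmg _ hx); last by move=> e; apply: wcomp_lin.
rewrite IH subr_eq addrC; case: eqP => _; last by rewrite mulr0.
by rewrite swordM.
Qed.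

Lemma scompK p q x : scomp p (scomp q x) = if p == q then scomp q x else 0.
Proof.
move: x; apply: sym_hext => [||d w hw].
- by move=> c x y; rewrite !scomp_lin.
- case: eqP => _; first exact: scomp_lin.
  by move=> c x y; rewrite scaler0 addr0.
rewrite (scomp_hword q hw); have [->|nqd] := eqVneq q d.
  by rewrite (scomp_hword p hw).
by rewrite (lin0 (scomp_lin p)); case: eqP.
Qed.

Lemma scomp_fin x : exists s : seq int, uniq s /\ x = \sum_(p <- s) scomp p x.
Proof.
suff [s Hs] : exists s : seq int, forall s', uniq s' -> {subset s <= s'} ->
    x = \sum_(p <- s') scomp p x.
  exists (undup s); split; first exact: undup_uniq.
  by apply: Hs; [exact: undup_uniq|move=> p; rewrite mem_undup].
move: x; apply: sym_hind => [|c x y [s Hs] [t Ht]|p w hw].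
- by exists [::] => s _ _; rewrite big1 // => p _; rewrite (lin0 (scomp_lin p)).
- exists (s ++ t) => r ur sub.
  rewrite {1}(Hs r) // => [|p ps]; last by apply: sub; rewrite mem_cat ps.
  rewrite {1}(Ht r) // => [|p pt]; last by apply: sub; rewrite mem_cat pt orbT.
  rewrite scaler_sumr -big_split; apply: eq_bigr => p _.
  by rewrite scomp_lin.
exists [:: p] => s us sub; rewrite (bigD1_seq p) //=; last first.
  by apply: sub; rewrite inE.
rewrite (scomp_hword p hw) eqxx big1 ?addr0 // => q /negbTE qp.
by rewrite (scomp_hword q hw) qp.
Qed.

Definition sgrading : grading S := Grading scomp_lin scompK scomp_fin.
Local Notation SG := (GrSpace sgrading).

Lemma sym_1 : hmg 0 (1 : SG).
Proof. by rewrite /hmg; apply: (scomp_hword 0 HNil). Qed.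

Lemma sym_M p q x y : @hmg _ SG p x -> @hmg _ SG q y ->
  @hmg _ SG (p + q) ((x : S) * y).
Proof.
have H : scomp (p + q) (scomp p x * scomp q y) = scomp p x * scomp q y.
  move: x; apply: sym_hext => [|| d v hv].
  - by move=> c x z; rewrite scomp_lin mulrDl -scalerAl scomp_lin.
  - by move=> c x z; rewrite scomp_lin mulrDl -scalerAl.
  move: y; apply: sym_hext => [|| e w hw].
  - by move=> c x z; rewrite scomp_lin mulrDr -scalerAr scomp_lin.
  - by move=> c x z; rewrite scomp_lin mulrDr -scalerAr.
  rewrite (scomp_hword p hv) (scomp_hword q hw).
  case: eqP => [->|_]; last by rewrite mul0r (lin0 (scomp_lin _)).
  case: eqP => [->|_]; last by rewrite mulr0 (lin0 (scomp_lin _)).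
  by rewrite swordM (scomp_hword _ (hword_cat hv hw)) eqxx.
by move=> hx hy; rewrite /hmg -{1}hx -{1}hy; rewrite -{2}hx -{2}hy; apply: H.
Qed.

Lemma sgen_swordC d e (y : W) w : hmg d y -> hword e w ->
  sgen y * sword w = (-1) ^+ absz (d * e) *: (sword w * sgen y).
Proof.
move=> hy; elim=> {e w} [|p q x w hx hw IH].
  by rewrite mulr0 expr0 scale1r !swordM.
rewrite mulrDr sgzD -scalerA.
have e1 : sword (x :: w) = sgen x * sword w by rewrite swordM.
have e2 : sgen y * sgen x = (-1) ^+ absz (d * p) *: (sgen x * sgen y).
  by rewrite !swordM; apply: ((sword_gsym W).2 [::] [::]).
by rewrite e1 mulrA e2 -scalerAl -!mulrA IH -scalerAr.
Qed.

Lemma swordC d e v w : hword d v -> hword e w ->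
  sword v * sword w = (-1) ^+ absz (d * e) *: (sword w * sword v).
Proof.
move=> hv hw; elim: hv => {d v} [|p q x v hx hv IH].
  by rewrite mul0r expr0 scale1r !swordM cats0.
have e1 : sword (x :: v) = sgen x * sword v by rewrite swordM.
rewrite e1 -[LHS]mulrA IH -scalerAr [X in _ *: X]mulrA (sgen_swordC hx hw).
by rewrite -scalerAl scalerA -mulrA mulrDl sgzD mulrC.
Qed.

Lemma sym_C p q x y : @hmg _ SG p x -> @hmg _ SG q y ->
  (x : S) * y = (-1) ^+ absz (p * q) *: ((y : S) * x).
Proof.
have H : scomp p x * scomp q y =
         (-1) ^+ absz (p * q) *: (scomp q y * scomp p x).
  move: x; apply: sym_hext => [|| d v hv].
  - by move=> c x z; rewrite scomp_lin mulrDl -scalerAl.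
  - by move=> c x z; rewrite scomp_lin mulrDr -scalerAr scalerDr !scalerA mulrC.
  move: y; apply: sym_hext => [|| e w hw].
  - by move=> c x z; rewrite scomp_lin mulrDr -scalerAr.
  - by move=> c x z; rewrite scomp_lin mulrDl -scalerAl scalerDr !scalerA mulrC.
  rewrite (scomp_hword p hv) (scomp_hword q hw).
  case: eqP => [->|_]; last by rewrite mul0r mulr0 scaler0.
  case: eqP => [->|_]; last by rewrite mul0r mulr0 scaler0.
  exact: swordC.
by move=> hx hy; rewrite -[X in X * _]hx -[X in _ * X]hy H; congr (_ *: (_ * _)).
Qed.

Definition symA : gcalg k := @GCAlg k S sgrading sym_1 sym_M sym_C.

Lemma sgen_hmg p (x : W) : hmg p x -> @hmg k symA p (sgen x).
Proof.
move=> hx; have := HCons hx HNil; rewrite addr0 => hw.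
by rewrite /hmg /gproj /= /sgen (scomp_hword p hw) eqxx.
Qed.

Definition gcalg_mor (A B : gcalg k) (phi : A -> B) : Prop :=
  [/\ linear phi, forall p v, @hmg k A p v -> @hmg k B p (phi v),
      phi 1 = 1 & forall x y, phi (x * y) = phi x * phi y].

Lemma hword_hmg_prod (A : gcalg k) (f : W -> A) p w :
  (forall p x, hmg p x -> @hmg k A p (f x)) -> hword p w ->
  @hmg k A p (\prod_(x <- w) f x).
Proof.
move=> hf; elim=> {p w} [|p q x w hx hw IH]; first by rewrite big_nil; apply: galg_1.
by rewrite big_cons; apply: galg_M => //; apply: hf.
Qed.

Lemma sym_free (A : gcalg k) (f : W -> A) :
  linear f -> (forall p x, hmg p x -> @hmg k A p (f x)) ->
  exists2 phi : symA -> A, gcalg_mor phi /\ (forall x, phi (sgen x) = f x) &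
    forall psi : symA -> A, gcalg_mor psi -> (forall x, psi (sgen x) = f x) ->
      psi =1 phi.
Proof.
move=> lf hf; pose F (w : seq W) : A := \prod_(x <- w) f x.
have gF : @gsymmetric k W A F.
  split=> [u v c x y|u v p q x y hx hy]; rewrite /F !big_cat /= !big_cons.
    by rewrite lf mulrDl mulrDr -scalerAl -scalerAr.
  rewrite [f x * _]mulrA (galg_C (hf _ _ hx) (hf _ _ hy)).
  by rewrite -scalerAl -scalerAr -mulrA.
pose phi : S -> A := slift F.
have phiw w : phi (sword w) = F w by apply: slift_word.
have lphi : linear phi by apply: slift_lin.
exists phi; first split.
- split=> //.
  + move=> p v hv.
    suff H : gproj A p (phi (scomp p v)) = phi (scomp p v).
      by rewrite /hmg -hv; apply: H.
    move: v {hv}; apply: sym_hext => [||q w hw].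
    * by move=> c x y; rewrite scomp_lin lphi (gprojP p).
    * by move=> c x y; rewrite scomp_lin lphi.
    rewrite (scomp_hword p hw); case: eqP => [->|_].
      by rewrite phiw; apply: (hword_hmg_prod hf hw).
    by rewrite (lin0 lphi) gproj0.
  + by rewrite phiw /F big_nil.
  move=> x y; move: x; apply: sym_ext => [||v].
  * by move=> c x z; rewrite mulrDl -scalerAl lphi.
  * by move=> c x z; rewrite lphi mulrDl -scalerAl.
  move: y; apply: sym_ext => [||w].
  * by move=> c x z; rewrite mulrDr -scalerAr lphi.
  * by move=> c x z; rewrite lphi mulrDr -scalerAr.
  by rewrite swordM !phiw /F big_cat.
- by move=> x; rewrite phiw /F big_seq1.
move=> psi [lpsi _ psi1 psiM] psig; apply: sym_ext => // w.
rewrite phiw /F; elim: w => [|x w IH]; first by rewrite big_nil.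
by rewrite big_cons -IH -psig -psiM swordM.
Qed.

End SymGrading.

Definition bilinear_map (k : fieldType) (A B M : lmodType k) (f : A * B -> M) : Prop :=
  (forall b, linear (fun a => f (a, b))) /\ (forall a, linear (fun b => f (a, b))).

Definition Tens (k : fieldType) (A B : lmodType k) :=
  umod (fun M => @bilinear_map k A B M).
HB.instance Definition _ (k : fieldType) (A B : lmodType k) :=
  GRing.Lmodule.on (Tens A B).

Definition tens (k : fieldType) (A B : lmodType k) (a : A) (b : B) : Tens A B :=
  ugen _ (a, b).
Definition tlift (k : fieldType) (A B M : lmodType k) (f : A -> B -> M) :
  Tens A B -> M := ulift (fun ab => f ab.1 ab.2).

Section TensFacts.
Variables (k : fieldType) (A B : lmodType k).
Lemma tens_linl (b : B) : linear (fun a : A => tens a b).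
Proof.
move=> c x y; apply: umod_eq => M f Pf.
apply: etrans (esym (ulift_lin Pf c (tens _ _) (tens _ _))).
by rewrite !ulift_gen // (Pf.1 b).
Qed.
Lemma tens_linr (a : A) : linear (fun b : B => tens a b).
Proof.
move=> c x y; apply: umod_eq => M f Pf.
apply: etrans (esym (ulift_lin Pf c (tens _ _) (tens _ _))).
by rewrite !ulift_gen // (Pf.2 a).
Qed.
Lemma tlift_tens (M : lmodType k) (f : A -> B -> M) a b :
  (forall b, linear (f^~ b)) -> (forall a, linear (f a)) ->
  tlift f (tens a b) = f a b.
Proof. by move=> f1 f2; rewrite /tlift ulift_gen //; split. Qed.
End TensFacts.

Section SymMaps.
Variables (k : fieldType) (W : grspace k).
Local Notation S := (Sym W).

(* The projections of S(W) onto the weight component S^n(W) and onto W. *)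
Definition spr (n : nat) : S -> S :=
  slift (fun w => if size w == n then sword w else 0).
Definition spr1 : S -> W := slift (fun w => if w is [:: x] then x else 0).

Lemma spr_gsym n :
  gsymmetric (fun w : seq W => if size w == n then sword w else 0).
Proof.
split=> [u v c x y|u v p q x y hx hy]; rewrite !size_cat /=; case: eqP => _.
- exact: (sword_gsym W).1.
- by rewrite scaler0 addr0.
- exact: (sword_gsym W).2.
by rewrite scaler0.
Qed.

Lemma spr1_gsym : gsymmetric (fun w => if w is [:: x] then x else 0 : W).
Proof.
split=> [[|z [|z' u]] [|z2 v] c x y|[|z [|z' u]] v p q x y hx hy] //=;
  by rewrite ?scaler0 ?addr0.
Qed.

Definition in_Sn (n : nat) (v : S) : Prop := spr n v = v.

(* Permutations of {0, ..., m-1} increasing on [0, n) and on [n, m). *)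
Definition is_shuffle (m n : nat) (s : 'S_m) : bool :=
  [forall i : 'I_m, forall j : 'I_m,
     [&& (i < j)%N & (j < n)%N || (n <= i)%N] ==> (s i < s j)%N].

(* Exponent of the Koszul sign of x_1...x_m -> x_s(1)...x_s(m), |x_i| = d i. *)
Definition koszul (m : nat) (d : 'I_m -> int) (s : 'S_m) : nat :=
  \sum_(i < m) \sum_(j < m | (i < j)%N && (s j < s i)%N) absz (d (s i) * d (s j))%R.

Definition letters (m : nat) (x : 'I_m -> W) (A : pred nat) : seq W :=
  [seq x i | i : 'I_m <- enum 'I_m & A i].

Definition shuffle_comult (c : S -> Tens S S) : Prop :=
  linear c /\
  forall (m : nat) (d : 'I_m -> int) (x : 'I_m -> W),
    (forall i, hmg (d i) (x i)) ->
    c (sword (letters x predT)) =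
      \sum_(n < m.+1) \sum_(s : 'S_m | is_shuffle n s) (-1) ^+ koszul d s *:
        tens (sword (letters (fun i => x (s i)) (fun i => i < n)%N))
             (sword (letters (fun i => x (s i)) (fun i => n <= i)%N)).

(* D (x) 1 + 1 (x) D for D of odd degree: 1 (x) D maps a (x) b to
   (-1)^|a| a (x) D b. *)
Definition tensder (D : S -> S) : Tens S S -> Tens S S :=
  tlift (fun a b => tens (D a) b
    + (tens (gpar (symA W) false a) (D b) - tens (gpar (symA W) true a) (D b))).

Lemma tensderE (D : S -> S) a b : linear D ->
  tensder D (tens a b) = tens (D a) b
    + (tens (gpar (symA W) false a) (D b) - tens (gpar (symA W) true a) (D b)).
Proof.
move=> lD; rewrite /tensder tlift_tens // => {a b} [b|a] c x y.
  rewrite /= lD !(@gpar_lin k (symA W)) !tens_linl scalerDr scalerBr.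
  by rewrite opprD [RHS]addrACA; congr (_ + _); apply: addrACA.
by rewrite lD !tens_linr scalerDr scalerBr opprD [RHS]addrACA; congr (_ + _);
   apply: addrACA.
Qed.

Definition odd_coderivation (D : S -> S) : Prop :=
  exists2 c, shuffle_comult c & forall v, c (D v) = tensder D (c v).

(* E is the coderivation D_n extending the n-th bracket l_n, with l the family
   of all brackets: l w = l_(size w) w. *)
Definition extends_bracket (l : seq W -> W) (n : nat) (E : S -> S) : Prop :=
  linear E /\
  forall (m : nat) (d : 'I_m -> int) (x : 'I_m -> W),
    (forall i, hmg (d i) (x i)) ->
    E (sword (letters x predT)) =
      if (n <= m)%N then
        \sum_(s : 'S_m | is_shuffle n s) (-1) ^+ koszul d s *:
          (sgen (l (letters (fun i => x (s i)) (fun i => i < n)%N))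
           * sword (letters (fun i => x (s i)) (fun i => n <= i)%N))
      else 0.

(* The brackets of D: the corestriction of D to the cogenerators W. *)
Definition bracket (D : S -> S) (w : seq W) : W := spr1 (D (sword w)).

End SymMaps.

Section LInfinity.
Variables (k : fieldType) (g : grspace k).
Local Notation S := (Sym (shift g 1)).

Record is_Linf (D : S -> S) : Prop := IsLinf {
  Linf_lin : linear D;
  Linf_deg : forall p v, @hmg k (symA (shift g 1)) p v ->
    @hmg k (symA (shift g 1)) (p + 1) (D v);
  Linf_coder : odd_coderivation D;
  Linf_sq : forall v, D (D v) = 0;
  Linf_1 : D 1 = 0
}.

Definition graded_subspace (A : g -> Prop) : Prop :=
  [/\ A 0, forall c u v, A u -> A v -> A (c *: u + v)
    & forall p v, A v -> A (gproj g p v)].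

Definition Linf_subspace (l : nat -> seq g -> g) (A : g -> Prop) : Prop :=
  graded_subspace A /\
  forall n a, (0 < n)%N -> size a = n -> {in a, forall v, A v} -> A (l n a).
End LInfinity.

Section BVInfinity.
Variables (k : fieldType) (V : gcalg k).

(* The even and odd parts of a linear operator E. *)
Definition opar (b : bool) (E : V -> V) (v : V) : V :=
  gpar V b (E (gpar V false v)) + gpar V (~~ b) (E (gpar V true v)).

(* The graded commutator: EF - (-1)^(|E||F|) FE on operators of definite parity. *)
Definition gcomm (E F : V -> V) (v : V) : V :=
  \sum_(b : bool) \sum_(c : bool)
    (opar b E (opar c F v) - (-1) ^+ (b && c) *: opar c F (opar b E v)).

Definition itercomm (D : V -> V) (a : seq V) : V -> V :=
  foldl (fun E x => gcomm E (fun b => x * b)) D a.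

Definition diffop (n : nat) (D : V -> V) : Prop :=
  forall a : seq V, size a = n.+1 -> forall v, itercomm D a v = 0.

(* Series in V[[hbar]] are given by their coefficients. *)
Definition bvop (Delta : nat -> V -> V) (v : V) : nat -> V :=
  fun i => Delta i.+1 v.
Definition bvext (Delta : nat -> V -> V) (s : nat -> V) : nat -> V :=
  fun m => \sum_(i < m.+1) Delta i.+1 (s (m - i)%N).

(* Delta n stands for Delta_n, n >= 1; Delta 0 is not used. As hbar has degree 2,
   a series has degree p when its coefficient of hbar^i has degree p - 2i. *)
Record is_BVinf (Delta : nat -> V -> V) : Prop := IsBVinf {
  BV_lin : forall n, (0 < n)%N -> linear (Delta n);
  BV_deg : forall (p : int) v, @hmg k V p v ->
    forall i : nat, @hmg k V (p + 1 - (2 * i)%:Z) (bvop Delta v i);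
  BV_order : forall n, (0 < n)%N -> diffop n (Delta n);
  BV_sq : forall s m, bvext Delta (bvext Delta s) m = 0;
  BV_1 : forall i, bvop Delta 1 i = 0
}.

Definition derived (Delta : nat -> V -> V) (n : nat) (a : seq V) : V :=
  itercomm (Delta n) a 1.
End BVInfinity.

Section Pure.
Variables (k : fieldType) (U : grspace k).

Definition is_pureBV (Delta : nat -> Sym U -> Sym U) : Prop :=
  is_BVinf (V := symA U) Delta /\
  forall n, (0 < n)%N ->
    (forall v, in_Sn n v -> exists u, Delta n v = sgen u) /\
    (forall m v, (m < n)%N -> in_Sn m v -> Delta n v = 0).

(* U[2] as the shift of g = U[1]. *)
Definition susp2 : grspace k := shift (shift U 1) 1.

(* The double suspension S^m(U[2]) = S^m(U), x_1...x_m |-> x_1...x_m. *)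
Definition dsusp : Sym susp2 -> Sym U :=
  @slift k susp2 (Sym U : lmodType k) (fun w : seq U => sword w).

Lemma dsusp_gsym :
  @gsymmetric k susp2 (Sym U : lmodType k) (fun w : seq U => sword w).
Proof.
split=> [u v c x y|u v p q x y hx hy]; first exact: (sword_gsym U).1.
have := (sword_gsym U).2 u v _ _ x y hx hy.
by rewrite sgz_shift.
Qed.

(* Delta = 1/hbar sum_(n >= 1) hbar^n D_n, D_n extending l_n. *)
Definition associated_BV (l : seq susp2 -> susp2) (Delta : nat -> Sym U -> Sym U) :
  Prop :=
  forall n, (0 < n)%N -> exists2 E, extends_bracket l n E &
    forall v, Delta n (dsusp v) = dsusp (E v).

Definition restricts_to (Delta : nat -> Sym U -> Sym U)
    (D : Sym susp2 -> Sym susp2) : Prop :=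
  forall n (x : seq U), (0 < n)%N -> size x = n ->
    derived (V := symA U) Delta n [seq sgen y | y <- x] = sgen (bracket D x : U).
End Pure.

(* Main.v *)
(* The operator Delta_n of a pure BV_infty-structure kills S^{<n}(U), sends S^n(U)
   to U and has order <= n. For a letter x the commutator [Delta_n, L_x] has the
   same three properties with n - 1 in place of n, and
   Delta_n (x v) = [Delta_n, L_x] v +- x Delta_n v. The coderivation with
   corestriction l satisfies the same recursion, with the corestriction l (x -)
   in the place of [Delta_n, L_x]; hence, by induction on n, Delta_n is the
   coderivation extending its restriction to S^n(U), and that restriction is the
   n-th derived bracket since the other terms of
   [..[Delta_n, L_{x_1}],.., L_{x_n}] 1 vanish. The components of D^2 = 0 are the
   coefficients of Delta^2 = 0. *)

(* perm also exports a constant Sym, which Defs has to shadow. *)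
From mathcomp Require Import perm zify.
Require Import Defs.
From mathcomp Require Import all_boot all_order all_algebra.
Set Implicit Arguments.
Unset Strict Implicit.
Unset Printing Implicit Defensive.
Import GRing.Theory.
Local Open Scope ring_scope.

(** * Maps of graded spaces and Koszul signs *)

(** Shuffle sums resist induction on words, so [coder l] is not defined by them: it is v |-> sum of
    l(v') v'' over the coproduct [comul], and [comul] is built one letter at a time from primitive
    elements. A word x w then yields the recursion at once, and shuffles occur only where [comul]
    and [coder] are compared with the explicit formulas. The commutator with L_x changes the degree
    by |x|, so the induction cannot stay with odd operators: coderivations are treated in an
    arbitrary degree e, with the sign carried by [gtwist]. On S(U) the operator Delta_n has degree 3
    - 2n. Reading a word of length n in U instead of U[2] adds 2n to its degree and reading the
    value there adds 2, so every bracket has degree one on U[2]; as these shifts are even, the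
    Koszul signs agree. The sum of all brackets is infinite as an operator, but on a word of length
    m only the first m of them act, so D and its square are finite sums there. *)

Section GradedMaps.
Variable k : fieldType.

Lemma gr_ext (V : grspace k) (M : lmodType k) (g h : V -> M) :
  linear g -> linear h -> (forall p v, hmg p v -> g v = h v) -> g =1 h.
Proof.
move=> lg lh e v; rewrite (gsuppE v) (lin_sum lg) (lin_sum lh).
by apply: eq_bigr => p _; apply: (e p); rewrite /hmg gprojK eqxx.
Qed.

Lemma hmgD (V : grspace k) p (u v : V) : hmg p u -> hmg p v -> hmg p (u + v).
Proof. by rewrite /hmg => hu hv; rewrite gprojD hu hv. Qed.
Lemma hmgZ (V : grspace k) p c (v : V) : hmg p v -> hmg p (c *: v).
Proof. by rewrite /hmg => hv; rewrite gprojZ hv. Qed.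

Definition gdeg (A B : grspace k) (e : int) (T : A -> B) : Prop :=
  forall p v, hmg p v -> hmg (p + e) (T v).

Lemma gpar_split (V : grspace k) (v : V) : gpar V false v + gpar V true v = v.
Proof.
have L : linear (fun v : V => gpar V false v + gpar V true v).
  by move=> c x y; rewrite !gpar_lin scalerDr addrACA.
move: v; apply: gr_ext L _ _ => // p v hv.
by rewrite !(gpar_hmg _ hv); case: odd; rewrite ?addr0 ?add0r.
Qed.

(* The Koszul sign operator: v |-> (-1)^(p|v|) v. *)
Definition gtwist (V : grspace k) (p : int) (v : V) : V :=
  if odd (absz p) then gpar V false v - gpar V true v else v.

Lemma gtwist_lin V p : linear (@gtwist V p).
Proof.
move=> c x y; rewrite /gtwist; case: odd => //.
by rewrite !gpar_lin scalerBr opprD addrACA.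
Qed.

Lemma gtwist_hmg (V : grspace k) p q (v : V) :
  hmg q v -> gtwist p v = (-1) ^+ absz (p * q) *: v.
Proof.
move=> hv; rewrite /gtwist !(gpar_hmg _ hv) abszM -signr_odd oddM.
by case: odd; case: odd; rewrite /= ?scale1r ?scaleN1r ?subr0 ?sub0r.
Qed.

Lemma gtwist_deg (A B : grspace k) e (T : A -> B) p v : linear T -> gdeg e T ->
  T (gtwist p v) = (-1) ^+ absz (p * e) *: gtwist p (T v).
Proof.
move=> lT dT; move: v; apply: gr_ext => [c x y|c x y|q v hv].
- by rewrite gtwist_lin lT.
- by rewrite lT gtwist_lin scalerDr !scalerA mulrC.
rewrite (gtwist_hmg p hv) (linZ lT) (gtwist_hmg p (dT _ _ hv)) scalerA.
rewrite mulrDr sgzD mulrCA -expr2 sqrr_sign mulr1 //.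
Qed.

Lemma gtwist_twist (V : grspace k) p q (v : V) :
  gtwist p (gtwist q v) = gtwist (p + q) v.
Proof.
move: v; apply: gr_ext => [c x y|c x y|d v hv]; rewrite ?gtwist_lin //.
rewrite !(gtwist_hmg _ hv) (linZ (@gtwist_lin V p)) (gtwist_hmg p hv) scalerA.
by rewrite mulrDl sgzD mulrC.
Qed.

End GradedMaps.

Section SymBasics.
Variables (k : fieldType) (W : grspace k).
Local Notation S := (Sym W).
Local Notation gS := (galg_gr (symA W)).

Lemma mulr_linr (a : S) : linear (fun b : S => a * b).
Proof. by move=> c x y; rewrite mulrDr scalerAr. Qed.
Lemma mulr_linl (b : S) : linear (fun a : S => a * b).
Proof. by move=> c x y; rewrite mulrDl scalerAl. Qed.

Lemma smulZl c (a b : S) : (c *: a) * b = c *: (a * b).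
Proof. exact: (linZ (mulr_linl b)). Qed.
Lemma smulZr c (a b : S) : a * (c *: b) = c *: (a * b).
Proof. exact: (linZ (mulr_linr a)). Qed.

Lemma sword_cons (x : W) w : sword (x :: w) = sgen x * sword w.
Proof. by rewrite swordM. Qed.

Lemma hword_hmg p (w : seq W) : hword p w -> @hmg k gS p (sword w).
Proof. by move=> hw; have := scomp_hword p hw; rewrite eqxx. Qed.

Lemma gdeg_words (B : grspace k) e (T : S -> B) : linear T ->
  (forall p w, hword p w -> hmg (p + e) (T (sword w))) -> @gdeg k gS B e T.
Proof.
move=> lT hT p v hv.
(* Homogeneity is not a linear condition on v. Replacing v by its component [scomp p v] makes the
   claim an equation of linear maps, which words can test. *)
suff H : forall v, gproj B (p + e) (T (scomp p v)) = T (scomp p v).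
  by have := H v; have -> : scomp p v = v by exact: hv.
apply: sym_hext => [c x y|c x y|q w hw]; rewrite ?scomp_lin ?lT ?gprojD ?gprojZ //.
rewrite (scomp_hword p hw); case: eqP => [->|_]; first exact: hT.
by rewrite (lin0 lT) gproj0.
Qed.

Lemma gen_swap p (x u : W) : hmg p x ->
  sgen (gtwist p u) * sgen x = sgen x * sgen u.
Proof.
move=> hx; move: u; apply: gr_ext => [c u v|c u v|q u hu].
- by rewrite gtwist_lin sgen_lin mulrDl scalerAl.
- by rewrite sgen_lin mulrDr scalerAr.
rewrite (gtwist_hmg p hu) (linZ (@sgen_lin k W)).
rewrite -scalerAl !swordM.
by rewrite [in RHS]((sword_gsym W).2 [::] [::] p q).
Qed.

Lemma gtwist_genM p q (x : W) (v : S) : hmg p x ->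
  @gtwist k gS q (sgen x * v) = (-1) ^+ absz (q * p) *: (sgen x * @gtwist k gS q v).
Proof.
move=> hx; move: v.
apply: (@gr_ext k gS) => [c u v|c u v|d v hv].
- by rewrite mulr_linr gtwist_lin.
- by rewrite gtwist_lin mulr_linr scalerDr !scalerA mulrC.
have hxv := @galg_M k (symA W) _ _ _ _ (sgen_hmg hx) hv.
rewrite (gtwist_hmg q hxv) (gtwist_hmg q hv) mulrDr sgzD.
by rewrite -scalerAr scalerA.
Qed.

Lemma gtwist_1 p : @gtwist k gS p 1 = 1.
Proof. by rewrite (gtwist_hmg p (galg_1 _)) mulr0 scale1r. Qed.

End SymBasics.

(** * The shuffle comultiplication *)

Section Comultiplication.
Variables (k : fieldType) (W : grspace k).
Local Notation S := (Sym W).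
Local Notation gS := (galg_gr (symA W)).
Local Notation T2 := (Tens S S).

Lemma tens_ext (M : lmodType k) (g h : T2 -> M) : linear g -> linear h ->
  (forall a b, g (tens a b) = h (tens a b)) -> g =1 h.
Proof. by move=> lg lh e; apply: umod_ext => // -[a b]; apply: e. Qed.

Lemma tlift_lin (M : lmodType k) (f : S -> S -> M) :
  (forall b, linear (f^~ b)) -> (forall a, linear (f a)) -> linear (tlift f).
Proof. by move=> f1 f2; apply: ulift_lin. Qed.

(* Multiplication by the primitive element x (x) 1 + 1 (x) x of S (x) S. *)
Definition prim_mul (x : W) : T2 -> T2 :=
  tlift (fun a b : S => tens (sgen x * a) b
    + (tens a (sgen (gpar W false x) * b)
       + tens (@gtwist k gS 1 a) (sgen (gpar W true x) * b))).

Lemma prim_mul_linl x b : linear (fun a : S => tens (sgen x * a) b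
    + (tens a (sgen (gpar W false x) * b)
       + tens (@gtwist k gS 1 a) (sgen (gpar W true x) * b))).
Proof.
move=> c a a'; rewrite mulr_linr gtwist_lin !tens_linl !scalerDr.
by rewrite [RHS]addrACA; congr (_ + _); apply: addrACA.
Qed.

Lemma prim_mul_linr x a : linear (fun b : S => tens (sgen x * a) b
    + (tens a (sgen (gpar W false x) * b)
       + tens (@gtwist k gS 1 a) (sgen (gpar W true x) * b))).
Proof.
move=> c b b'; rewrite !mulr_linr !tens_linr !scalerDr.
by rewrite [RHS]addrACA; congr (_ + _); apply: addrACA.
Qed.

Lemma prim_mul_lin x : linear (prim_mul x).
Proof. by apply: tlift_lin => *; [exact: prim_mul_linl|exact: prim_mul_linr]. Qed.

Lemma prim_mulE x a b : prim_mul x (tens a b) = tens (sgen x * a) b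
    + (tens a (sgen (gpar W false x) * b)
       + tens (@gtwist k gS 1 a) (sgen (gpar W true x) * b)).
Proof.
by rewrite /prim_mul tlift_tens // => *;
  [exact: prim_mul_linl|exact: prim_mul_linr].
Qed.

Lemma sgen0 : sgen (0 : W) = 0. Proof. exact: lin0 (@sgen_lin k W). Qed.
Lemma tens0r (a : S) : tens a (0 : S) = 0.
Proof. exact: (lin0 (tens_linr a)). Qed.

Lemma prim_mul_hmg p x a b : hmg p x ->
  prim_mul x (tens a b) = tens (sgen x * a) b
    + tens (@gtwist k gS p a) (sgen x * b).
Proof.
move=> hx; rewrite prim_mulE !(gpar_hmg _ hx) /gtwist.
by case: odd; rewrite /= sgen0 mul0r tens0r ?addr0 ?add0r.
Qed.

(** [comul] has to be linear in letters that need not be homogeneous; this is why [prim_mul] uses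
    the parity parts of x and not a degree. *)
Lemma prim_mul_linx t : linear (prim_mul^~ t).
Proof.
move=> c x y; move: t; apply: tens_ext => [||a b].
- exact: prim_mul_lin.
- move=> d t t'; rewrite !prim_mul_lin !scalerDr !scalerA [in RHS]addrACA.
  by rewrite [c * d]mulrC.
rewrite !prim_mulE !gpar_lin !sgen_lin !mulr_linl tens_linl !tens_linr !scalerDr.
by rewrite [RHS]addrACA; congr (_ + _); apply: addrACA.
Qed.

(** The symmetry that lets the fold over a word descend to S(W). Within one factor x and y commute
    as in S(W); the two mixed terms trade places, and moving a twist past a letter gives the
    sign. *)
Lemma prim_mulC p q x y t : hmg p x -> hmg q y ->
  prim_mul x (prim_mul y t) = (-1) ^+ absz (p * q) *: prim_mul y (prim_mul x t).
Proof.
move=> hx hy; move: t; apply: tens_ext => [||a b].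
- exact: (lin_comp (@prim_mul_lin y) (@prim_mul_lin x)).
- by move=> c t t'; rewrite !prim_mul_lin scalerDr !scalerA mulrC.
rewrite (prim_mul_hmg _ _ hy) (prim_mul_hmg _ _ hx).
rewrite !(linD (@prim_mul_lin _)) !(prim_mul_hmg _ _ hx) !(prim_mul_hmg _ _ hy).
have C : sgen x * sgen y = (-1) ^+ absz (p * q) *: (sgen y * sgen x).
  by rewrite !swordM; apply: ((sword_gsym W).2 [::] [::]).
rewrite !mulrA C -!scalerAl (linZ (tens_linl _)) (linZ (tens_linr _)).
rewrite (gtwist_genM _ _ hx) (gtwist_genM _ _ hy) !(linZ (tens_linl _)).
rewrite !gtwist_twist [q + p]addrC !scalerDr !scalerA [q * p]mulrC.
rewrite -expr2 sqrr_sign scale1r -!addrA; congr (_ + _).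
by rewrite !addrA [X in X + _]addrC.
Qed.

(** The algebra map S -> S (x) S with primitive generators, written as a composite of the operators
    [prim_mul] applied to 1 (x) 1. *)
Definition comul : S -> T2 :=
  slift (fun w => foldr prim_mul (tens (1 : S) (1 : S)) w).

Lemma comul_gsym :
  gsymmetric (fun w => foldr prim_mul (tens (1 : S) (1 : S)) w).
Proof.
split=> [u v c x y|u v p q x y hx hy]; rewrite !foldr_cat /=.
  elim: u => [|z u IH] /=; first exact: prim_mul_linx.
  by rewrite IH prim_mul_lin.
elim: u => [|z u IH] /=; first exact: prim_mulC.
by rewrite IH (linZ (@prim_mul_lin z)).
Qed.

Lemma comul_lin : linear comul.
Proof. exact: slift_lin comul_gsym. Qed.
Lemma comul_1 : comul 1 = tens (1 : S) (1 : S).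
Proof. by rewrite [LHS](slift_word [::] comul_gsym). Qed.
Lemma comul_gen x v : comul (sgen x * v) = prim_mul x (comul v).
Proof.
move: v; apply: sym_ext => [||w].
- exact: (lin_comp (mulr_linr _) comul_lin).
- exact: (lin_comp comul_lin (@prim_mul_lin x)).
by rewrite swordM /comul !(slift_word _ comul_gsym).
Qed.

(** [tensder] for an operator of any degree e: the recursion leads from degree e to p + e, so the
    odd case alone is not closed under the induction. *)
Definition gtensder (e : int) (E : S -> S) : T2 -> T2 :=
  tlift (fun a b : S => tens (E a) b + tens (@gtwist k gS e a) (E b)).

Section GTensder.
Variables (e : int) (E : S -> S).
Hypothesis lE : linear E.
Lemma gtensder_linl b :
  linear (fun a : S => tens (E a) b + tens (@gtwist k gS e a) (E b)).
Proof. by move=> c a a'; rewrite lE gtwist_lin !tens_linl scalerDr addrACA. Qed.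
Lemma gtensder_linr a :
  linear (fun b : S => tens (E a) b + tens (@gtwist k gS e a) (E b)).
Proof. by move=> c b b'; rewrite lE !tens_linr scalerDr addrACA. Qed.
Lemma gtensderE a b :
  gtensder e E (tens a b) = tens (E a) b + tens (@gtwist k gS e a) (E b).
Proof.
by rewrite /gtensder tlift_tens // => *; [exact: gtensder_linl|exact: gtensder_linr].
Qed.
Lemma gtensder_lin : linear (gtensder e E).
Proof. by apply: tlift_lin => *; [exact: gtensder_linl|exact: gtensder_linr]. Qed.
End GTensder.

Lemma tensder_gtensder (E : S -> S) : linear E -> tensder E =1 gtensder 1 E.
Proof.
move=> lE; apply: tens_ext => [||a b].
- apply: tlift_lin => [b|a] c x y.
    rewrite /= lE !(@gpar_lin k (symA W)) !tens_linl scalerDr scalerBr.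
    by rewrite opprD [RHS]addrACA; congr (_ + _); apply: addrACA.
  rewrite lE !tens_linr scalerDr scalerBr opprD [RHS]addrACA; congr (_ + _).
  exact: addrACA.
- exact: gtensder_lin.
rewrite tensderE // gtensderE //; congr (_ + _).
by rewrite /gtwist /= -!scaleN1r (linD (tens_linl _)) (linZ (tens_linl _)).
Qed.

End Comultiplication.

(** * Coderivations with a given corestriction *)

Section Coderivations.
Variables (k : fieldType) (W : grspace k).
Local Notation S := (Sym W).
Local Notation gS := (galg_gr (symA W)).
Local Notation T2 := (Tens S S).

Lemma comul_sgen x :
  comul (sgen x : S) = tens (sgen x : S) (1 : S) + tens (1 : S) (sgen x : S).
Proof.
rewrite -[in LHS](mulr1 (sgen x)) comul_gen comul_1 prim_mulE gtwist_1 !mulr1.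
by rewrite -(linD (tens_linr _)) -(linD (@sgen_lin _ _)) gpar_split.
Qed.

(* The coderivation of S(W) with corestriction l : S(W) -> W. *)
Definition coder_map (l : S -> W) : T2 -> S :=
  tlift (fun a b : S => sgen (l a) * b).
Definition coder (l : S -> W) : S -> S := fun v => coder_map l (comul v).

Section Coder.
Variable l : S -> W.
Hypothesis ll : linear l.

Lemma coder_map_linl b : linear (fun a : S => sgen (l a) * b).
Proof. by move=> c a a'; rewrite ll sgen_lin mulr_linl. Qed.
Lemma coder_mapE a b : coder_map l (tens a b) = sgen (l a) * b.
Proof.
by rewrite /coder_map tlift_tens // => *; [exact: coder_map_linl|exact: mulr_linr].
Qed.
Lemma coder_map_lin : linear (coder_map l).
Proof. by apply: tlift_lin => *; [exact: coder_map_linl|exact: mulr_linr]. Qed.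
Lemma coder_lin : linear (coder l).
Proof. by move=> c x y; rewrite /coder comul_lin coder_map_lin. Qed.
Lemma coder_1 : coder l 1 = sgen (l 1).
Proof. by rewrite /coder comul_1 coder_mapE mulr1. Qed.

Lemma lmul_lin (x : S) : linear (fun a : S => l (x * a)).
Proof. exact: (lin_comp (mulr_linr x) ll). Qed.
End Coder.

Lemma eq_coder (l l' : S -> W) : linear l -> linear l' -> l =1 l' -> coder l =1 coder l'.
Proof.
move=> ll ll' e v; rewrite /coder; move: (comul v); apply: tens_ext => [||a b].
- exact: coder_map_lin.
- exact: coder_map_lin.
by rewrite !coder_mapE // e.
Qed.

Lemma lmul_deg (l : S -> W) e p x : @gdeg k gS W e l -> hmg p x ->
  @gdeg k gS W (p + e) (fun a : S => l (sgen x * a)).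
Proof.
move=> dl hx q a ha; rewrite addrCA addrA.
exact: dl (@galg_M k (symA W) _ _ _ _ (sgen_hmg hx) ha).
Qed.

(** The left half of [prim_mul x] inserts x into the argument of l. The right half leaves x outside:
    the twist of a becomes a twist of l(a) at the price of (-1)^(pe), and [gen_swap] absorbs it when
    x moves to the front. *)
Lemma coder_gen (l : S -> W) e p x v : linear l -> @gdeg k gS W e l -> hmg p x ->
  coder l (sgen x * v) = coder (fun a : S => l (sgen x * a)) v
    + (-1) ^+ absz (p * e) *: (sgen x * coder l v).
Proof.
move=> ll dl hx; have llx := lmul_lin ll (sgen x).
rewrite /coder comul_gen; move: (comul v); apply: tens_ext => [||a b].
- exact: (lin_comp (@prim_mul_lin _ _ x) (coder_map_lin ll)).
- move=> c t t'; rewrite !coder_map_lin // mulr_linr !scalerDr !scalerA.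
  by rewrite [_ * c]mulrC addrACA.
rewrite (prim_mul_hmg _ _ hx) (linD (coder_map_lin ll)) !coder_mapE //.
congr (_ + _); rewrite (@gtwist_deg k gS W e l p a ll dl).
rewrite (linZ (@sgen_lin k W)) smulZl; congr (_ *: _).
by rewrite mulrA (gen_swap _ hx) mulrA.
Qed.

(** Induction along [coder_gen]: the tail w is used both for l and for l(x -), of degree p + e, so l
    and e must vary. *)
Lemma coder_hind (Q : (S -> W) -> int -> S -> Prop) :
  (forall l e, linear l -> @gdeg k gS W e l -> Q l e 1) ->
  (forall l e p x w, linear l -> @gdeg k gS W e l -> hmg p x ->
     Q l e (sword w) -> Q (fun a => l (sgen x * a)) (p + e) (sword w) ->
     Q l e (sgen x * sword w)) ->
  forall l e q w, linear l -> @gdeg k gS W e l -> hword q w -> Q l e (sword w).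
Proof.
move=> Q1 Qx l e q w ll dl hw; elim: hw l e ll dl => [|p d x u hx hu IH] l e ll dl.
  exact: Q1.
rewrite sword_cons; apply: (Qx l e p) => //; apply: IH => //.
- exact: lmul_lin.
- exact: lmul_deg.
Qed.

Lemma coder_deg (l : S -> W) e : linear l -> @gdeg k gS W e l ->
  @gdeg k gS gS e (coder l).
Proof.
move=> ll dl; apply: gdeg_words => [|p w hw]; first exact: coder_lin.
elim: hw l e ll dl => {p w} [|p q x w hx hw IH] l e ll dl.
  rewrite coder_1 //; apply: sgen_hmg; apply: dl; exact: galg_1.
rewrite sword_cons (coder_gen _ ll dl hx).
have h1 := IH _ _ (lmul_lin ll (sgen x)) (lmul_deg dl hx).
have h2 := @galg_M k (symA W) _ _ _ _ (sgen_hmg hx) (IH _ _ ll dl).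
rewrite addrA in h2; apply: (@hmgD k gS); last exact: hmgZ h2.
by rewrite addrA [q + p]addrC in h1.
Qed.

Lemma comul_coder (l : S -> W) e v : linear l -> @gdeg k gS W e l ->
  comul (coder l v) = gtensder e (coder l) (comul v).
Proof.
move=> ll dl; move: v; apply: sym_hext => [||p w hw].
- by move=> c x y; rewrite coder_lin // comul_lin.
- by move=> c x y; rewrite comul_lin gtensder_lin //; apply: coder_lin.
pose Q l e v := comul (coder l v) = gtensder e (coder l) (comul v).
rewrite -/(Q l e (sword w)); apply: (coder_hind _ _ ll dl hw) => {l e p w ll dl hw}
  [l e ll dl|l e p x w ll dl hx]; rewrite /Q; last move=> IH IHx.
  rewrite coder_1 // comul_1 gtensderE; last exact: coder_lin.
  by rewrite gtwist_1 coder_1 // comul_sgen.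
have llx := lmul_lin ll (sgen x).
rewrite comul_gen (coder_gen _ ll dl hx) (linD (@comul_lin _ _)) IHx.
rewrite (linZ (@comul_lin _ _)) comul_gen IH.
have lc := coder_lin ll; have lcx := coder_lin llx.
(* What remains is an identity of operators on S (x) S: [gtensder] of [coder l] obeys with
   [prim_mul x] the recursion that [coder l] obeys with x. On a (x) b it is [coder_gen] in each
   factor. *)
move: (comul (sword w)); apply: tens_ext => [||a b].
- move=> c s t; rewrite !gtensder_lin // prim_mul_lin scalerDr !scalerDr !scalerA.
  by rewrite [_ * c]mulrC addrACA.
- by move=> c s t; rewrite prim_mul_lin gtensder_lin.
rewrite (prim_mul_hmg _ _ hx) (linD (gtensder_lin e lc)) !gtensderE //.
rewrite (linD (@prim_mul_lin _ _ x)) !(prim_mul_hmg _ _ hx).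
rewrite !(coder_gen _ ll dl hx) (gtwist_genM _ _ hx).
rewrite (@gtwist_deg k gS gS e (coder l) p a lc (coder_deg ll dl)).
rewrite !(linD (tens_linl _)) !(linD (tens_linr _)) !(linZ (tens_linl _)).
rewrite !(linZ (tens_linr _)) !gtwist_twist [e + p]addrC [e * p]mulrC.
rewrite !scalerDr -!addrA; congr (_ + _).
rewrite [LHS]addrCA; congr (_ + _).
by rewrite [LHS]addrCA [RHS]addrCA; congr (_ + _); apply: addrCA.
Qed.

Lemma scounit_lin : linear (@scounit k W).
Proof. exact: slift_lin (scounit_gsym W). Qed.
Lemma scounit_gen x v : scounit (sgen x * v : S) = 0.
Proof.
move: v; apply: sym_ext => [||w].
- exact: (lin_comp (mulr_linr _) scounit_lin).
- by move=> c y z; rewrite scaler0 addr0.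
by rewrite -sword_cons /scounit slift_word //; apply: scounit_gsym.
Qed.
Lemma scounit_1 : scounit (1 : S) = 1.
Proof. by rewrite [LHS](slift_word [::] (scounit_gsym W)). Qed.

Definition rcounit : T2 -> S := tlift (fun a b : S => (scounit b : k) *: a).
Lemma rcounit_linl (b : S) : linear (fun a : S => (scounit b : k) *: a).
Proof. by move=> c x y; rewrite scalerDr !scalerA mulrC. Qed.
Lemma rcounit_linr (a : S) : linear (fun b : S => (scounit b : k) *: a).
Proof. by move=> c x y; rewrite scounit_lin scalerDl scalerA. Qed.
Lemma rcounit_lin : linear rcounit.
Proof. by apply: tlift_lin => *; [exact: rcounit_linl|exact: rcounit_linr]. Qed.
Lemma rcounitE a b : rcounit (tens a b) = (scounit b : k) *: a.
Proof.
by rewrite /rcounit tlift_tens // => *; [exact: rcounit_linl|exact: rcounit_linr].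
Qed.

(** The counit law: each term in which a letter has entered the right factor is killed. *)
Lemma comul_rcounit v : rcounit (comul v) = v.
Proof.
move: v; apply: sym_ext => [||w] //.
  by move=> c x y; rewrite comul_lin rcounit_lin.
elim: w => [|x w IH].
  by rewrite [comul _]comul_1 rcounitE scounit_1 scale1r.
rewrite sword_cons comul_gen -[in RHS]IH; move: (comul (sword w)).
apply: tens_ext => [||a b].
- exact: (lin_comp (@prim_mul_lin _ _ x) rcounit_lin).
- exact: (lin_comp rcounit_lin (mulr_linr _)).
rewrite prim_mulE !(linD rcounit_lin) !rcounitE !scounit_gen !scale0r !addr0.
by rewrite smulZr.
Qed.

Lemma spr1_lin : linear (@spr1 k W).
Proof. exact: slift_lin (spr1_gsym W). Qed.
Lemma spr1_word w : spr1 (sword w) = if w is [:: x] then x else 0 : W.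
Proof. by rewrite /spr1 slift_word //; apply: spr1_gsym. Qed.
Lemma spr1_gen x : spr1 (sgen x) = x :> W.
Proof. exact: spr1_word. Qed.
Lemma spr1_genM x v : spr1 (sgen x * v) = (scounit v : k) *: x :> W.
Proof.
move: v; apply: sym_ext => [||w].
- exact: (lin_comp (mulr_linr _) spr1_lin).
- by move=> c u v; rewrite scounit_lin scalerDl scalerA.
rewrite -sword_cons spr1_word /scounit slift_word; last exact: scounit_gsym.
by case: w => [|y w]; rewrite ?scale1r ?scale0r.
Qed.

(** [spr1] of l(a) b is counit(b) l(a), so the left side is l after [rcounit] and [comul], and the
    counit law applies. *)
Lemma spr1_coder (l : S -> W) v : linear l -> spr1 (coder l v) = l v.
Proof.
move=> ll; rewrite -[in RHS](comul_rcounit v) /coder; move: (comul v).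
apply: tens_ext => [||a b].
- exact: (lin_comp (coder_map_lin ll) spr1_lin).
- exact: (lin_comp rcounit_lin ll).
by rewrite coder_mapE // spr1_genM rcounitE (linZ ll).
Qed.

Lemma spr_lin n : linear (@spr k W n).
Proof. exact: slift_lin (spr_gsym W n). Qed.
Lemma spr_word n w : spr n (sword w) = if size w == n then sword w else 0 :> S.
Proof. by rewrite /spr slift_word //; apply: spr_gsym. Qed.
Lemma spr_genS n x v : spr n.+1 (sgen x * v) = sgen x * spr n v :> S.
Proof.
move: v; apply: sym_ext => [||w].
- exact: (lin_comp (mulr_linr _) (@spr_lin _)).
- exact: (lin_comp (@spr_lin _) (mulr_linr _)).
rewrite -sword_cons !spr_word /= eqSS; case: eqP => _; last by rewrite mulr0.
by rewrite sword_cons.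
Qed.
Lemma spr_gen0 x v : spr 0 (sgen x * v) = 0 :> S.
Proof.
move: v; apply: sym_ext => [||w]; last by rewrite -sword_cons spr_word.
- exact: (lin_comp (mulr_linr _) (@spr_lin _)).
- by move=> c y z; rewrite scaler0 addr0.
Qed.
Lemma sprK m n v : spr m (spr n v) = if m == n then spr n v else 0 :> S.
Proof.
move: v; apply: sym_ext => [||w].
- exact: (lin_comp (@spr_lin _) (@spr_lin _)).
- by case: eqP => _; [exact: spr_lin|move=> c x y; rewrite scaler0 addr0].
rewrite [spr n _]spr_word; case: eqP => [<-|_].
  by rewrite spr_word eq_sym; case: eqP.
by rewrite (lin0 (@spr_lin m)); case: eqP.
Qed.
Lemma spr_deg n : @gdeg k gS gS 0 (@spr k W n).
Proof.
apply: gdeg_words => [|p w hw]; first exact: spr_lin.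
rewrite spr_word addr0; case: eqP => _; first exact: hword_hmg.
by rewrite /hmg gproj0.
Qed.
Lemma spr1_deg : @gdeg k gS W 0 (@spr1 k W).
Proof.
apply: gdeg_words => [|p w hw]; first exact: spr1_lin.
rewrite spr1_word addr0; case: hw => [|q r x u hx hu]; first by rewrite /hmg gproj0.
by case: hu => [|*]; rewrite ?addr0 // /hmg gproj0.
Qed.

End Coderivations.

(** * Weights of coderivations *)

Section Weights.
Variables (k : fieldType) (W : grspace k).
Local Notation S := (Sym W).
Local Notation gS := (galg_gr (symA W)).

Lemma coder0 (l : S -> W) v : (forall v, l v = 0) -> coder l v = 0.
Proof.
move=> l0; have ll : linear l by move=> c x y; rewrite !l0 scaler0 addr0.
rewrite /coder; move: (comul v); apply: tens_ext => [||a b].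
- exact: coder_map_lin.
- by move=> c s t; rewrite scaler0 addr0.
by rewrite coder_mapE // l0 sgen0 mul0r.
Qed.

(** l takes n letters and returns one, so the weight changes by 1 - n. In the induction l(x -)
    factors through weight n - 1, hence n varies. *)
Lemma coder_word_weight (l : S -> W) e q n w : linear l -> @gdeg k gS W e l ->
  (forall v, l v = l (spr n v)) -> hword q w ->
  coder l (sword w) =
    if (n <= size w)%N then spr (size w + 1 - n) (coder l (sword w)) else 0.
Proof.
move=> ll dl ln hw; elim: hw n l e ll dl ln => {q w} [|p q x w hx hw IH] n l e ll dl ln.
  rewrite [sword [::]]/(1 : S) coder_1 //=; case: n ln => [|n] ln /=.
    by rewrite spr_word.
  by rewrite ln spr_word (lin0 ll) sgen0.
rewrite /= sword_cons (coder_gen _ ll dl hx).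
have lx := lmul_lin ll (sgen x); have dx := lmul_deg dl hx.
have {}IHx : coder (fun a : S => l (sgen x * a)) (sword w) = if (n <= (size w).+1)%N
  then spr ((size w).+1 + 1 - n) (coder (fun a : S => l (sgen x * a)) (sword w)) else 0.
  (* At n = 0 there is no n - 1 to pass to; there l(x -) is zero. *)
  case: n ln => [|n] ln.
    have z v : l (sgen x * v) = 0 by rewrite ln spr_gen0 (lin0 ll).
    rewrite coder0 //.
    by rewrite (lin0 (@spr_lin _ _ _)).
  rewrite ltnS addSn subSS; apply: (IH _ _ _ lx dx) => v.
  by rewrite ln spr_genS.
rewrite {1}IHx {1}(IH _ _ _ ll dl ln) addSn.
(* The bounds n <= size w + 1 and n <= size w of the two terms differ only at n = size w + 1, where
   [coder l] kills w. *)
case: (ltngtP n (size w).+1) => [|h|en].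
- rewrite ltnS => h; rewrite h.
  by rewrite subSn ?spr_lin ?addn1 ?(leqW h) // (linD (@spr_lin _ _ _))
     (linZ (@spr_lin _ _ _)) spr_genS subSn.
- by rewrite leqNgt (ltnW h) /= mulr0 scaler0 addr0.
by rewrite (IH _ _ _ ll dl ln) en ltnn mulr0 scaler0 !addr0.
Qed.

(** l is the sum of its weight components, and those of weight above the length of w contribute
    nothing, so the sum is finite on each word. *)
Lemma coder_sum_weights (l : S -> W) e q w : linear l -> @gdeg k gS W e l ->
  hword q w ->
  coder l (sword w) = \sum_(n < (size w).+1) coder (fun v => l (spr n v)) (sword w).
Proof.
have lspr (h : S -> W) n : linear h -> linear (fun v => h (spr n v)).
  by move=> lh; apply: (lin_comp (@spr_lin _ _ n) lh).
have dspr (h : S -> W) d n : @gdeg k gS W d h -> @gdeg k gS W d (fun v => h (spr n v)).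
  by move=> dh p v hv; apply: dh; rewrite -[p]addr0; apply: spr_deg.
move=> ll dl hw; elim: hw l e ll dl => {q w} [|p q x w hx hw IH] l e ll dl.
  rewrite big_ord1 [sword [::]]/(1 : S) !coder_1 ?spr_word //; exact: lspr.
have lx := lmul_lin ll (sgen x); have dx := lmul_deg dl hx.
rewrite sword_cons (coder_gen _ ll dl hx) (IH _ _ lx dx) (IH _ _ ll dl).
under [RHS]eq_bigr => n _ do
  rewrite (coder_gen _ (lspr _ n ll) (dspr _ _ n dl) hx).
rewrite big_split /=; congr (_ + _).
  (* Weight n + 1 of x v is x times weight n of v, so the index shifts by one and the n = 0 summand
     must vanish: its map is zero, so it factors through weight size w + 1, too large for w. *)
  rewrite [RHS]big_ord_recl [X in X + _](_ : _ = 0) ?add0r; last first.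
    have h := @coder_word_weight (fun a => l (spr 0 (sgen x * a))) (p + e) q
      (size w).+1 w _ _ _ hw.
    rewrite h ?ltnn //.
    - exact: (lmul_lin (lspr _ 0%N ll)).
    - exact: (lmul_deg (dspr _ _ 0%N dl) hx).
    by move=> v; rewrite !spr_gen0.
  apply: eq_bigr => n _.
  have lxS := lmul_lin (lspr _ n.+1 ll) (sgen x).
  by apply: (eq_coder (lspr _ n lx) lxS) => v; rewrite spr_genS.
rewrite -scaler_sumr -mulr_sumr; congr (_ *: (_ * _)).
(* Here the index does not shift; the surplus top summand has weight size w + 1, too large for w. *)
rewrite [RHS]big_ord_recr /= [X in _ + X](_ : _ = 0) ?addr0 //.
rewrite (coder_word_weight (n := (size w).+1) (lspr _ _ ll) (dspr _ _ _ dl) _ hw)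
  ?ltnn //.
by move=> v; rewrite sprK eqxx.
Qed.

End Weights.

(** * Differential operators as coderivations *)

Section Commutators.
Variable k : fieldType.

Lemma odd_abszD (p q : int) : odd (absz (p + q)) = odd (absz p) (+) odd (absz q).
Proof. lia. Qed.

Variable V : gcalg k.

Lemma opar_lin b (E : V -> V) : linear E -> linear (opar b E).
Proof.
move=> lE c x y; rewrite /opar !(@gpar_lin k V) !lE !(@gpar_lin k V) scalerDr.
by rewrite [RHS]addrACA.
Qed.

Lemma opar_split (E : V -> V) v : linear E -> opar true E v + opar false E v = E v.
Proof.
move=> lE; rewrite /opar /= addrACA.
rewrite [gpar V true _ + _]addrC !(@gpar_split k V) -(linD lE).
by rewrite (@gpar_split k V).
Qed.

Lemma opar_deg b (E : V -> V) e v : linear E -> @gdeg k V V e E ->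
  opar b E v = if odd (absz e) == b then E v else 0.
Proof.
move=> lE dE; move: v; apply: (@gr_ext k V) => [||p v hv].
- exact: opar_lin.
- by case: (_ == b) => // c x y; rewrite scaler0 addr0.
rewrite /opar !(gpar_hmg _ hv); have := gpar_hmg _ (dE _ _ hv).
move: (odd_abszD p e); case: (odd (absz p)); case: (odd (absz e)) => /= -> H;
  case: b; rewrite /= ?H ?(lin0 lE) ?(lin0 (@gpar_lin k V _)) /= ?addr0 ?add0r //.
Qed.

Lemma gcomm_lin (E F : V -> V) : linear E -> linear F -> linear (gcomm E F).
Proof.
move=> lE lF c x y; rewrite /gcomm scaler_sumr -big_split; apply: eq_bigr => b _.
rewrite /= scaler_sumr -big_split; apply: eq_bigr => d _.
rewrite /= (opar_lin d lF) !(opar_lin b lE) (opar_lin d lF).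
rewrite [_ ^+ _ *: (_ + _)]scalerDr opprD !scalerBr !scalerA [_ * c]mulrC.
by rewrite [LHS]addrACA.
Qed.

Lemma gcomm_deg (E F : V -> V) e f v : linear E -> linear F ->
  @gdeg k V V e E -> @gdeg k V V f F ->
  gcomm E F v = E (F v) - (-1) ^+ absz (f * e) *: F (E v).
Proof.
move=> lE lF dE dF; rewrite abszM -signr_odd oddM /gcomm !big_bool /=.
rewrite !(opar_deg _ _ lE dE) !(opar_deg _ _ lF dF).
case: (odd (absz e)); case: (odd (absz f)) => /=;
by rewrite ?(lin0 lE) ?(lin0 lF) ?scaler0 ?subr0 ?addr0 ?add0r.
Qed.

(** The terms with F outside vanish at v, and the remaining parity parts of E and F add up to E(F
    v), whatever the degrees. *)
Lemma gcomm_kill (E F : V -> V) v : linear E -> linear F ->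
  (forall b, opar b E v = 0) -> gcomm E F v = E (F v).
Proof.
move=> lE lF z; rewrite /gcomm.
have oF0 b : opar b F 0 = 0 by apply: lin0 (opar_lin b lF).
rewrite !big_bool /= !z !oF0 !scaler0 !subr0 addrACA !opar_split //.
by rewrite -(linD lE) opar_split.
Qed.

End Commutators.

(** * Operators of bounded order that vanish in low weight *)

Section Order.
Variables (k : fieldType) (W : grspace k).
Local Notation S := (Sym W).
Local Notation gS := (galg_gr (symA W)).

Lemma spr_gpar n b v : spr n (gpar gS b v) = gpar gS b (spr n v).
Proof.
move: v; apply: sym_hext => [||p w hw].
- exact: (lin_comp (@gpar_lin k gS b) (@spr_lin _ _ n)).
- exact: (lin_comp (@spr_lin _ _ n) (@gpar_lin k gS b)).
rewrite (gpar_hmg b (hword_hmg hw)) spr_word (fun_if (gpar gS b)).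
rewrite (gpar_hmg b (hword_hmg hw)) (lin0 (@gpar_lin k gS b)).
by case: eqP; rewrite ?spr_word ?(lin0 (@spr_lin _ _ _)) //; case: eqP.
Qed.

Lemma mul_gen_deg p (x : W) : hmg p x -> @gdeg k gS gS p (fun b : S => sgen x * b).
Proof.
move=> hx q v hv; rewrite addrC.
exact: (@galg_M k (symA W) _ _ _ _ (sgen_hmg hx) hv).
Qed.

Lemma gcomm_gen (T : S -> S) e p (x : W) v : linear T -> @gdeg k gS gS e T ->
  hmg p x -> gcomm (V := symA W) T (fun b : S => sgen x * b) v =
    T (sgen x * v) - (-1) ^+ absz (p * e) *: (sgen x * T v).
Proof.
move=> lT dT hx.
exact: (gcomm_deg (V := symA W) v lT (mulr_linr (sgen x)) dT (mul_gen_deg hx)).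
Qed.

(** T vanishes in weight below n = size x, so by [gcomm_kill] its commutator with L_y acts there as
    v |-> T(y v), and this vanishes in weight below n - 1. The argument covers letters that are not
    homogeneous. *)
Lemma itercomm_gens (T : S -> S) (x : seq W) : linear T ->
  (forall m v, (m < size x)%N -> T (spr m v) = 0) ->
  itercomm (V := symA W) T [seq sgen y | y <- x] 1 = T (sword x).
Proof.
elim: x T => [|x w IH] T lT kT //.
have lx : linear (fun b : S => sgen x * b) by apply: mulr_linr.
have kill m v : (m < size (x :: w))%N ->
    gcomm (V := symA W) T (fun b : S => sgen x * b) (spr m v) = T (spr m.+1 (sgen x * v)).
  move=> lm; rewrite spr_genS; apply: (gcomm_kill (V := symA W)) => // b.
  by rewrite /opar -!spr_gpar !kT // !(lin0 (@gpar_lin k gS _)) addr0.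
rewrite -[LHS]/(itercomm (V := symA W) (gcomm (V := symA W) T
  (fun b : S => sgen x * b)) [seq sgen y | y <- w] 1) IH.
- have -> : sword w = spr (size w) (sword w) by rewrite spr_word eqxx.
  by rewrite kill //= spr_genS spr_word eqxx sword_cons.
- exact: (gcomm_lin (V := symA W)).
by move=> m v lm; rewrite kill ?kT //= leqW.
Qed.

(** The descent ends at order 0, where T commutes with every L_x: both sides are then multiplication
    by T 1. *)
Lemma diffop_coder n (T : S -> S) e : linear T -> @gdeg k gS gS e T ->
  diffop (V := symA W) n T ->
  (forall m v, (m < n)%N -> T (spr m v) = 0) ->
  (forall v, exists u, T (spr n v) = sgen u) ->
  T =1 coder (fun v => spr1 (T (spr n v))).
Proof.
elim: n T e => [|n IH] T e lT dT oT kT gT.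
  have l1 : linear (fun v => spr1 (T (spr 0 v)) : W).
    exact: (lin_comp (lin_comp (@spr_lin _ _ 0) lT) (@spr1_lin _ _)).
  have d1 : @gdeg k gS W e (fun v => spr1 (T (spr 0 v))).
    move=> p v hv; rewrite -[p + e]addr0; apply: spr1_deg; apply: dT.
    by rewrite -[p]addr0; apply: spr_deg.
  apply: sym_hext => [||q w hw]; [exact: lT|exact: coder_lin|].
  elim: hw => {q w} [|p q x w hx hw IHw].
    have [u] := gT (sword [::]); rewrite spr_word /= => hu.
    by rewrite [sword [::]]/(1 : S) coder_1 // [spr 0 1]spr_word hu spr1_gen.
  rewrite sword_cons (coder_gen _ l1 d1 hx) -IHw coder0 ?add0r; last first.
    by move=> v; rewrite spr_gen0 (lin0 lT) (lin0 (@spr1_lin _ _)).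
  have : gcomm (V := symA W) T (fun b : S => sgen x * b) (sword w) = 0.
    exact: (oT [:: sgen x]).
  by rewrite (gcomm_gen _ lT dT hx) => /eqP; rewrite subr_eq0 => /eqP.
have l1 : linear (fun v => spr1 (T (spr n.+1 v)) : W).
  exact: (lin_comp (lin_comp (@spr_lin _ _ n.+1) lT) (@spr1_lin _ _)).
have d1 : @gdeg k gS W e (fun v => spr1 (T (spr n.+1 v))).
  move=> p v hv; rewrite -[p + e]addr0; apply: spr1_deg; apply: dT.
  by rewrite -[p]addr0; apply: spr_deg.
apply: sym_hext => [||q w hw]; [exact: lT|exact: coder_lin|].
elim: hw => {q w} [|p q x w hx hw IHw].
  rewrite [sword [::]]/(1 : S) coder_1 // spr_word /=.
  rewrite (lin0 lT) (lin0 (@spr1_lin _ _)) sgen0.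
  by have := kT 0%N 1 isT; rewrite [spr 0 1]spr_word.
rewrite sword_cons (coder_gen _ l1 d1 hx) -IHw.
have lx : linear (fun b : S => sgen x * b) by apply: mulr_linr.
pose T' := gcomm (V := symA W) T (fun b : S => sgen x * b).
have T'E v : T' v = T (sgen x * v) - (-1) ^+ absz (p * e) *: (sgen x * T v).
  exact: gcomm_gen.
have lT' : linear T' by apply: (gcomm_lin (V := symA W)).
have dT' : @gdeg k gS gS (p + e) T'.
  move=> r v hv; rewrite T'E -scaleNr; apply: (@hmgD k gS).
    rewrite addrA [r + p]addrC; apply: dT.
    exact: (@galg_M k (symA W) _ _ _ _ (sgen_hmg hx) hv).
  apply: (@hmgZ k gS); rewrite addrCA.
  exact: (@galg_M k (symA W) _ _ _ _ (sgen_hmg hx) (dT _ _ hv)).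
have oT' : diffop (V := symA W) n T'.
  by move=> a sa v; apply: (oT (sgen x :: a : seq S)); rewrite /= sa.
(* Below weight n + 1 the term x T(-) is zero. This one formula gives the vanishing of T' below
   weight n, its values in W on weight n, and its corestriction l(x -). *)
have kT' m v : (m < n.+1)%N -> T' (spr m v) = T (spr m.+1 (sgen x * v)).
  by move=> lm; rewrite T'E kT // mulr0 scaler0 subr0 spr_genS.
have := IH T' _ lT' dT' oT' _ _ (sword w).
rewrite T'E => H; apply/eqP; rewrite -subr_eq; apply/eqP.
rewrite H.
- have ex v : spr1 (T' (spr n v)) = spr1 (T (spr n.+1 (sgen x * v))) :> W.
    by rewrite kT'.
  apply: eq_coder ex _.
  + exact: (lin_comp (lin_comp (@spr_lin _ _ n) lT') (@spr1_lin _ _)).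
  exact: (lmul_lin l1 (sgen x)).
- by move=> m v lm; rewrite kT' ?kT // leqW.
by move=> v; rewrite kT'.
Qed.

End Order.

(** * Sums over shuffles *)

Section Shuffles.

Lemma lift_perm_inj m (i j : 'I_m.+1) : injective (lift_perm i j).
Proof.
move=> s t e; apply/perm.permP => a; apply: (@lift_inj _ j).
by rewrite -!(lift_perm_lift i) e.
Qed.

Lemma lift_perm_onto m (i j : 'I_m.+1) (s : 'S_m.+1) :
  s i = j -> exists t, s = lift_perm i j t.
Proof.
move=> si; pose f a := odflt a (unlift j (s (lift i a))).
have fE a : lift j (f a) = s (lift i a).
  have : j != s (lift i a) by rewrite -si (inj_eq perm_inj) neq_lift.
  by rewrite /f => /unlift_some [b -> ->].
have fI : injective f.
  by move=> a b e; apply: (@lift_inj _ i); apply: (@perm_inj _ s); rewrite -!fE e.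
exists (perm fI); apply/perm.permP => a; case: (unliftP i a) => [b|] ->.
  by rewrite lift_perm_lift permE fE.
by rewrite lift_perm_id.
Qed.

Lemma sum_lift_perm (M : nmodType) m (i j : 'I_m.+1) (P : pred 'S_m.+1)
    (F : 'S_m.+1 -> M) :
  \sum_(s | P s && (s i == j)) F s =
  \sum_(t | P (lift_perm i j t)) F (lift_perm i j t).
Proof.
(* g inverts [lift_perm i j]; its default value is reached only by permutations that do not send i
   to j. *)
pose g s := odflt (1%g : 'S_m) [pick t | s == lift_perm i j t].
rewrite (reindex_onto (lift_perm i j) g) => [|s /andP[_ /eqP si]].
  apply: eq_bigl => t; rewrite lift_perm_id eqxx andbT.
  rewrite /g; case: pickP => [u /eqP /lift_perm_inj ->|/(_ t)]; last by rewrite eqxx.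
  by rewrite eqxx andbT.
have [t st] := lift_perm_onto si.
by rewrite /g; case: pickP => [u /eqP //|/(_ t)]; rewrite {1}st eqxx.
Qed.

Lemma shuffleP m n (s : 'S_m) :
  reflect (forall i j : 'I_m, (i < j)%N -> (j < n)%N || (n <= i)%N -> (s i < s j)%N)
          (is_shuffle n s).
Proof.
apply: (iffP 'forall_forallP) => [h i j ij ijn|h i j].
  by have := h i j; rewrite ij ijn.
by apply/implyP => /andP[]; apply: h.
Qed.

Lemma shuffle_lift0 m n (s : 'S_m) :
  is_shuffle n.+1 (lift_perm ord0 ord0 s) = is_shuffle n s.
Proof.
apply/shuffleP/shuffleP => h i j ij ijn.
  by have := h (lift ord0 i) (lift ord0 j) ij ijn; rewrite !lift_perm_lift.
move: ij ijn; case: (unliftP ord0 j) => [j'|] -> //.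
rewrite lift_perm_lift; case: (unliftP ord0 i) => [i'|] ->.
  by rewrite lift_perm_lift; apply: h.
by rewrite lift_perm_id.
Qed.

(** i is both the position of the new value 0 and the size of the first block: the value opens the
    second block and leaves the first as it was. *)
Lemma shuffle_lift m (i : 'I_m.+1) (s : 'S_m) :
  is_shuffle i (lift_perm i ord0 s) = is_shuffle i s.
Proof.
have bl (a : 'I_m) : (lift i a < i)%N = (a < i)%N by rewrite /= /bump; lia.
have bg (a : 'I_m) : (i <= lift i a)%N = (i <= a)%N by rewrite /= /bump; lia.
have bb (a b : 'I_m) : (lift i a < lift i b)%N = (a < b)%N.
  by rewrite /= /bump; lia.
apply/shuffleP/shuffleP => h a b ab abi.
  by have := h (lift i a) (lift i b); rewrite bb bl bg !lift_perm_lift => /(_ ab abi).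
move: ab abi; case: (unliftP i b) => [b'|] ->; last first.
  by move=> ab; rewrite ltnn leqNgt ab.
rewrite lift_perm_lift; case: (unliftP i a) => [a'|] ->; last by rewrite lift_perm_id.
by rewrite bb bl bg lift_perm_lift => ab abi; apply: h.
Qed.

(** At any other position of the value 0, an earlier position of the same block would need a value
    below 0. *)
Lemma shuffle_lift_neq m n (i : 'I_m.+1) (s : 'S_m) : (n <= m.+1)%N ->
  i != 0%N :> nat -> i != n :> nat -> is_shuffle n (lift_perm i ord0 s) = false.
Proof.
move=> nm i0 ni; apply/negP => /shuffleP h.
have [lt|ge] := ltnP i n.
  by have := h ord0 i; rewrite lt lift_perm_id lt0n i0 => /(_ isT isT).
have ltn : (n < i)%N by rewrite ltn_neqAle eq_sym ni.
have ltm : (n < m.+1)%N by apply: leq_trans ltn (ltnW (ltn_ord i)).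
by have := h (Ordinal ltm) i; rewrite /= ltn leqnn orbT lift_perm_id => /(_ isT isT).
Qed.

(* A shuffle takes the value 0 at the start of the first or of the second block. *)
Lemma sum_shuffles (M : nmodType) m n (F : 'S_m.+1 -> M) : (n <= m.+1)%N ->
  \sum_(s | is_shuffle n s) F s =
    (if n is n'.+1 then
       \sum_(s : 'S_m | is_shuffle n' s) F (lift_perm ord0 ord0 s) else 0)
  + (if (n <= m)%N then
       \sum_(s : 'S_m | is_shuffle n s) F (lift_perm (inord n) ord0 s) else 0).
Proof.
move=> nm; rewrite (partition_big (fun s : 'S_m.+1 => (s^-1)%g ord0) predT) //=.
have E i : \sum_(s | is_shuffle n s && ((s^-1)%g ord0 == i)) F s =
    \sum_(t | is_shuffle n (lift_perm i ord0 t)) F (lift_perm i ord0 t).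
  rewrite -sum_lift_perm; apply: eq_bigl => s.
  by congr (_ && _); rewrite -[LHS](inj_eq (@perm_inj _ s)) permKV eq_sym.
rewrite (eq_bigr _ (fun i _ => E i)) {E}.
rewrite (bigD1 ord0) //=.
(* With n = 0 the first block is empty and position 0 opens the second one, so everything goes to
   the second summand. *)
case: n nm => [|n] nm.
  rewrite add0r [X in _ + X]big1 ?addr0 => [|i i0]; last first.
    by rewrite big_pred0 // => s; apply: shuffle_lift_neq.
  have -> : inord 0 = ord0 :> 'I_m.+1 by apply: val_inj; rewrite /= inordK.
  by apply: eq_bigl => s; apply: (shuffle_lift ord0).
congr (_ + _); first by apply: eq_bigl => s; rewrite shuffle_lift0.
case: ifP => [nm'|nm']; last first.
  rewrite big1 // => i i0; rewrite big_pred0 // => s.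
  apply: shuffle_lift_neq => //; move: (ltn_ord i) nm' => /=; lia.
have vn : (inord n.+1 : 'I_m.+1) = n.+1 :> nat by rewrite inordK.
rewrite (bigD1 (inord n.+1)) /=; last by rewrite -val_eqE /= vn.
rewrite [X in _ + X]big1 ?addr0 => [|i /andP[i0 ni]].
  apply: eq_bigl => s; have := shuffle_lift (inord n.+1 : 'I_m.+1) s.
  by rewrite vn.
rewrite big_pred0 // => s; apply: shuffle_lift_neq => //.
by apply: contra ni => /eqP e; rewrite -val_eqE /= vn e.
Qed.

(** Each shuffle of m letters extends in two ways: the new first letter enters the first block,
    which grows to n + 1, or the second. These are the two summands of [prim_mul]. *)
Lemma sum_all_shuffles (M : nmodType) m (F : nat -> 'S_m.+1 -> M) :
  \sum_(n < m.+2) \sum_(s | is_shuffle n s) F n s =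
  \sum_(n < m.+1) \sum_(s : 'S_m | is_shuffle n s)
    (F n.+1 (lift_perm ord0 ord0 s) + F n (lift_perm (inord n) ord0 s)).
Proof.
rewrite (eq_bigr _ (fun (n : 'I_m.+2) _ => sum_shuffles (F n) (ltn_ord n))).
rewrite big_split /= big_ord_recl add0r [X in _ + X]big_ord_recr /= ltnn addr0.
rewrite -big_split /=; apply: eq_bigr => n _.
by rewrite -ltnS ltn_ord -big_split.
Qed.

(** The smallest value at position i is inverted with exactly the positions before i; all other
    inversions are those of s. *)
Lemma koszul_lift m (d : 'I_m.+1 -> int) (i : 'I_m.+1) (s : 'S_m) :
  koszul d (lift_perm i ord0 s) =
    (\sum_(a < m | a < i) absz (d (lift ord0 (s a)) * d ord0)%R
     + koszul (fun a => d (lift ord0 a)) s)%N.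
Proof.
rewrite /koszul (bigD1_ord i) //= big1 ?add0n => [|j /andP[]]; last first.
  by rewrite lift_perm_id.
under eq_bigr => a _.
  rewrite big_mkcond (bigD1_ord i) //= lift_perm_lift lift_perm_id.
  rewrite [X in (X + _)%N](_ : _ = if (a < i)%N
    then absz (d (lift ord0 (s a)) * d ord0)%R else 0%N); last first.
    by rewrite andbT /bump; congr (if _ then _ else _); lia.
  rewrite -big_mkcond /=.
  under eq_bigl => b do rewrite lift_perm_lift.
  over.
rewrite big_split /= -big_mkcond /=; congr (_ + _)%N.
apply: eq_bigr => a _; apply: eq_big => [b|b _]; last by rewrite lift_perm_lift.
by rewrite /= /bump; lia.
Qed.

End Shuffles.

(** * Subwords selected by shuffles, and the shuffle formula for [comul] and [coder] *)

Section Letters.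
Variables (k : fieldType) (W : grspace k).
Local Notation S := (Sym W).
Local Notation gS := (galg_gr (symA W)).

Lemma val_filter_enum m (A : pred nat) :
  [seq val i | i : 'I_m <- enum 'I_m & A i] = [seq i <- iota 0 m | A i].
Proof. by rewrite -val_enum_ord filter_map. Qed.

Lemma filter_iota0_lt m n : (n <= m)%N -> [seq i <- iota 0 m | (i < n)%N] = iota 0 n.
Proof. exact: filter_iota_ltn. Qed.

Lemma filter_iota0_ge m n : (n <= m)%N ->
  [seq i <- iota 0 m | (n <= i)%N] = iota n (m - n).
Proof.
move=> nm; rewrite -{1}(subnKC nm) iotaD filter_cat add0n.
rewrite (eq_in_filter (a2 := pred0)) ?filter_pred0 => [|i]; last first.
  by rewrite mem_iota add0n /= => lt; rewrite leqNgt lt.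
by apply/all_filterP/allP => i; rewrite mem_iota => /andP[].
Qed.

Lemma eq_letters m (x y : 'I_m -> W) A : x =1 y -> letters x A = letters y A.
Proof. by move=> e; rewrite /letters; apply: eq_map. Qed.

Lemma letters0 (x : 'I_0 -> W) A : letters x A = [::].
Proof.
by rewrite /letters; have -> : enum 'I_0 = [::] by apply/size0nil; rewrite size_enum_ord.
Qed.

Lemma letters_all m (x : 'I_m.+1 -> W) :
  letters x predT = x ord0 :: letters (fun i => x (lift ord0 i)) predT.
Proof. by rewrite /letters !filter_predT enum_ordSl /= -map_comp. Qed.

Lemma letters_ltS m n (x : 'I_m.+1 -> W) : letters x (fun i => i < n.+1)%N =
  x ord0 :: letters (fun i => x (lift ord0 i)) (fun i => i < n)%N.
Proof. by rewrite /letters enum_ordSl /= filter_map -map_comp. Qed.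

Lemma letters_geS m n (x : 'I_m.+1 -> W) : letters x (fun i => n.+1 <= i)%N =
  letters (fun i => x (lift ord0 i)) (fun i => n <= i)%N.
Proof. by rewrite /letters enum_ordSl /= filter_map -map_comp. Qed.

Lemma map_val_lift m (i : 'I_m.+1) (r : seq 'I_m) :
  map val (map (lift i) r) = map (bump i) (map val r).
Proof. by rewrite -!map_comp. Qed.

Lemma letters_lt_lift m (i : 'I_m.+1) (x : 'I_m.+1 -> W) :
  letters x (fun a => a < i)%N = letters (fun a => x (lift i a)) (fun a => a < i)%N.
Proof.
have im : (i <= m)%N by rewrite -ltnS.
rewrite /letters [RHS](map_comp x (lift i)); congr map; apply: (inj_map val_inj).
rewrite map_val_lift.
rewrite !(val_filter_enum _ (fun a => a < i)%N) !filter_iota0_lt ?(leqW im) //.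
rewrite -[LHS]map_id; apply/eq_in_map => a.
by rewrite mem_iota add0n /bump /=; lia.
Qed.

Lemma letters_ge_lift m (i : 'I_m.+1) (x : 'I_m.+1 -> W) :
  letters x (fun a => i <= a)%N =
    x i :: letters (fun a => x (lift i a)) (fun a => i <= a)%N.
Proof.
have im : (i <= m)%N by rewrite -ltnS.
rewrite /letters [in RHS](map_comp x (lift i)) -map_cons; congr map.
apply: (inj_map val_inj) => /=.
rewrite map_val_lift.
rewrite !(val_filter_enum _ (fun a => i <= a)%N) !filter_iota0_ge ?(leqW im) //.
rewrite subSn //=; congr (_ :: _).
rewrite -[i.+1]add1n iotaDl; apply/eq_in_map => a.
by rewrite mem_iota /bump => /andP[-> _].
Qed.

Lemma size_letters_lt m n (x : 'I_m -> W) : (n <= m)%N ->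
  size (letters x (fun i => i < n)%N) = n.
Proof.
move=> nm; rewrite size_map -(size_map val) (val_filter_enum _ (fun i => i < n)%N).
by rewrite filter_iota0_lt // size_iota.
Qed.

Lemma letters_hword m (d : 'I_m -> int) (x : 'I_m -> W) (A : pred nat) :
  (forall i, hmg (d i) (x i)) -> hword (\sum_(i < m | A i) d i) (letters x A).
Proof.
move=> hx; have -> : \sum_(i < m | A i) d i = \sum_(i <- enum 'I_m | A i) d i.
  by rewrite big_enum_cond.
rewrite -big_filter /letters.
elim: [seq _ <- _ | _] => [|i r IH]; rewrite ?big_nil ?big_cons; first exact: HNil.
exact: HCons.
Qed.

Lemma signz_sum I (r : seq I) (P : pred I) (F : I -> int) (p : int) :
  (-1) ^+ absz (p * \sum_(i <- r | P i) F i) =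
  (-1) ^+ (\sum_(i <- r | P i) absz (F i * p)%R)%N :> k.
Proof.
rewrite mulr_sumr; elim/big_rec2: _ => [|i n q _ IH] //.
by rewrite sgzD IH exprD [F i * p]mulrC.
Qed.

Lemma shuffle_comult_comul : shuffle_comult (@comul k W).
Proof.
split; first exact: comul_lin.
elim=> [|m IH] d x hx.
  rewrite letters0 big_ord1 [comul _]comul_1 (big_pred1 (1%g : 'S_0)) => [|s].
    by rewrite !letters0 /koszul big_ord0 scale1r.
  transitivity true; first by apply/shuffleP => -[].
  by symmetry; apply/eqP/perm.permP => -[].
have hx' i : hmg (d (lift ord0 i)) (x (lift ord0 i)) by [].
rewrite letters_all sword_cons comul_gen (IH _ _ hx') (lin_sum (@prim_mul_lin _ _ _)).
pose F (n : nat) (s : 'S_m.+1) := (-1) ^+ koszul d s *: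
  tens (sword (letters (fun i => x (s i)) (fun i => i < n)%N) : S)
       (sword (letters (fun i => x (s i)) (fun i => n <= i)%N) : S).
rewrite [RHS](sum_all_shuffles F); apply: eq_bigr => n _.
rewrite (lin_sum (@prim_mul_lin _ _ _)); apply: eq_bigr => s _; rewrite /F.
rewrite (linZ (@prim_mul_lin _ _ _)) (prim_mul_hmg _ _ (hx ord0)) scalerDr.
have vn : (inord n : 'I_m.+1) = n :> nat by rewrite inordK.
have e t i A : letters (fun a => x (lift_perm i ord0 t (lift i a))) A =
    letters (fun a => x (lift ord0 (t a))) A.
  by apply: eq_letters => a; rewrite lift_perm_lift.
congr (_ + _).
  rewrite koszul_lift big_pred0 // letters_ltS letters_geS !e lift_perm_id.
  by rewrite sword_cons.
move: vn; set i := inord n => vn.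
rewrite koszul_lift -vn letters_lt_lift letters_ge_lift !e lift_perm_id.
rewrite exprD mulrC -scalerA sword_cons; congr (_ *: _).
have hs : forall i, hmg (d (lift ord0 (s i))) (x (lift ord0 (s i))) by [].
(* The left factor consists of the letters that the first letter jumps over, so its twist is the new
   part of the Koszul exponent. *)
have hw := letters_hword (fun a => a < i)%N hs.
rewrite (gtwist_hmg _ (hword_hmg hw)) (linZ (tens_linl _)).
by rewrite (signz_sum _ _ (fun a => d (lift ord0 (s a)))).
Qed.

(** In the shuffle formula l meets a left factor of length i, so only i = n survives, and for m < n
    there is no such i. *)
Lemma coder_extends (l : S -> W) (b : seq W -> W) n : linear l ->
  (forall w, l (sword w) = if size w == n then b w else 0) ->
  extends_bracket b n (coder l).
Proof.
move=> ll lb; split=> [|m d x hx]; first exact: coder_lin.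
rewrite /coder (shuffle_comult_comul.2 m d x hx) (lin_sum (coder_map_lin ll)).
have E (i : 'I_m.+1) : coder_map l (\sum_(s : 'S_m | is_shuffle i s)
      (-1) ^+ koszul d s *:
        tens (sword (letters (fun i => x (s i)) (fun a => a < i)%N) : S)
             (sword (letters (fun i => x (s i)) (fun a => i <= a)%N) : S)) =
    if i == n :> nat then \sum_(s : 'S_m | is_shuffle i s) (-1) ^+ koszul d s *:
        (sgen (b (letters (fun i => x (s i)) (fun a => a < i)%N))
           * sword (letters (fun i => x (s i)) (fun a => i <= a)%N)) else 0.
  have sz s : size (letters (fun i => x (fun_of_perm s i)) (fun a => a < i)%N) = i.
    by rewrite size_letters_lt // -ltnS.
  rewrite (lin_sum (coder_map_lin ll)); case: (eqVneq (i : nat) n) => [en|ni].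
    apply: eq_bigr => s _; rewrite (linZ (coder_map_lin ll)) coder_mapE // lb.
    by rewrite sz en eqxx.
  rewrite big1 // => s _; rewrite (linZ (coder_map_lin ll)) coder_mapE // lb.
  by rewrite sz (negbTE ni) sgen0 mul0r scaler0.
rewrite (eq_bigr _ (fun i _ => E i)) -big_mkcond /=.
case: ifP => [nm|mn]; last first.
  rewrite big_pred0 // => i; apply/eqP => e.
  by move: (ltn_ord i); rewrite ltnS e mn.
have lt : (n < m.+1)%N by [].
by rewrite (big_pred1 (Ordinal lt)).
Qed.

Lemma hword_letters p (w : seq W) : hword p w ->
  exists d x, (forall i : 'I_(size w), hmg (d i) (x i)) /\ w = letters x predT.
Proof.
move=> hw; suff [ds h] : exists ds : seq int,
    forall i, (i < size w)%N -> hmg (nth 0 ds i) (nth 0 w i).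
  exists (fun i => nth 0 ds i), (fun i => nth 0 w i); split=> [i|]; first exact: h.
  rewrite /letters filter_predT (map_comp (nth 0 w) val) val_enum_ord.
  by rewrite -[LHS](mkseq_nth 0).
elim: hw => [|q r x u hx _ [ds h]]; first by exists [::].
by exists (q :: ds); case=> [|i] //=; rewrite ltnS; apply: h.
Qed.

Lemma extends_bracket_uniq (b : seq W -> W) n (E F : S -> S) :
  extends_bracket b n E -> extends_bracket b n F -> E =1 F.
Proof.
move=> [lE hE] [lF hF]; apply: sym_hext => // p w /hword_letters [d [x [hx ->]]].
by rewrite (hE _ _ _ hx) (hF _ _ _ hx).
Qed.

End Letters.

(** * The double suspension *)

Section Suspension.
Variables (k : fieldType) (U : grspace k).
Local Notation W := (susp2 U).
Local Notation gU := (galg_gr (symA U)).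
Local Notation gW := (galg_gr (symA W)).

Lemma hmg_susp2 p (x : U) : @hmg k W p x <-> hmg (p + 2) x.
Proof. by rewrite addrC -[2]/(1 + 1 : int) -addrA. Qed.

Lemma hword_susp2 p (w : seq U) : @hword k W p w -> hword (p + (2 * size w)%:Z) w.
Proof.
elim=> [|q r x u hx _ IH]; first exact: HNil.
have -> : q + r + (2 * size (x :: u))%:Z = (q + 2) + (r + (2 * size u)%:Z).
  by rewrite /=; lia.
by apply: HCons => //; apply/hmg_susp2.
Qed.

Lemma dsusp_lin : linear (@dsusp k U).
Proof. exact: slift_lin (dsusp_gsym U). Qed.
Lemma dsusp_word (w : seq U) : dsusp (sword (w : seq W)) = sword w.
Proof. by rewrite /dsusp slift_word //; apply: dsusp_gsym. Qed.
Lemma dsusp_gen (x : U) : dsusp (sgen (x : W)) = sgen x.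
Proof. exact: dsusp_word. Qed.

Lemma usp_gsym :
  @gsymmetric k U (Sym W : lmodType k) (fun w => sword (w : seq W)).
Proof.
split=> [u v c x y|u v p q x y hx hy]; first exact: (sword_gsym W).1.
have hx' : @hmg k W (p - 2) x by apply/hmg_susp2; rewrite subrK.
have hy' : @hmg k W (q - 2) y by apply/hmg_susp2; rewrite subrK.
rewrite ((sword_gsym W).2 u v _ _ x y hx' hy') -sgz_shift; congr ((-1) ^+ absz _ *: _).
by congr (_ * _); lia.
Qed.

Definition usp : Sym U -> Sym W :=
  @slift k U (Sym W : lmodType k) (fun w => sword (w : seq W)).
Lemma usp_lin : linear usp.
Proof. exact: slift_lin usp_gsym. Qed.
Lemma usp_word (w : seq U) : usp (sword w) = sword (w : seq W).
Proof. by rewrite /usp slift_word //; apply: usp_gsym. Qed.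

Lemma dsuspK : cancel (@dsusp k U) usp.
Proof.
apply: sym_ext => [||w] //; last by rewrite dsusp_word usp_word.
exact: (lin_comp dsusp_lin usp_lin).
Qed.
Lemma uspK : cancel usp (@dsusp k U).
Proof.
apply: sym_ext => [||w] //; last by rewrite usp_word dsusp_word.
exact: (lin_comp usp_lin dsusp_lin).
Qed.

Lemma dsuspM (a b : Sym W) : dsusp (a * b) = dsusp a * dsusp b.
Proof.
move: a; apply: sym_ext => [||v].
- exact: (lin_comp (mulr_linl b) dsusp_lin).
- exact: (lin_comp dsusp_lin (mulr_linl _)).
move: b; apply: sym_ext => [||w].
- exact: (lin_comp (mulr_linr _) dsusp_lin).
- exact: (lin_comp dsusp_lin (mulr_linr _)).
by rewrite swordM !dsusp_word swordM.
Qed.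

Lemma dsusp_spr n (v : Sym W) : dsusp (spr n v) = spr n (dsusp v).
Proof.
move: v; apply: sym_ext => [||w].
- exact: (lin_comp (@spr_lin _ _ n) dsusp_lin).
- exact: (lin_comp dsusp_lin (@spr_lin _ _ n)).
rewrite dsusp_word !spr_word; case: eqP => _; first by rewrite dsusp_word.
exact: (lin0 dsusp_lin).
Qed.

Lemma dsusp_twist p (v : Sym W) :
  dsusp (@gtwist k gW p v) = @gtwist k gU (p + 2) (dsusp v).
Proof.
move: v; apply: sym_hext => [||q w hw].
- exact: (lin_comp (@gtwist_lin k gW p) dsusp_lin).
- exact: (lin_comp dsusp_lin (@gtwist_lin k gU (p + 2))).
rewrite (gtwist_hmg p (hword_hmg hw)) (linZ dsusp_lin) dsusp_word.
rewrite (gtwist_hmg _ (hword_hmg (hword_susp2 hw))); congr (_ *: _).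
rewrite -signr_odd -[RHS]signr_odd; congr (_ ^+ nat_of_bool _).
by rewrite !abszM !oddM !odd_abszD /= addbF; congr (_ && _); lia.
Qed.

Definition dsusp2 : Tens (Sym W) (Sym W) -> Tens (Sym U) (Sym U) :=
  tlift (fun a b : Sym W => tens (dsusp a : Sym U) (dsusp b : Sym U)).
Lemma dsusp2_linl (b : Sym W) :
  linear (fun a : Sym W => tens (dsusp a : Sym U) (dsusp b : Sym U)).
Proof. by move=> c x y; rewrite dsusp_lin tens_linl. Qed.
Lemma dsusp2_linr (a : Sym W) :
  linear (fun b : Sym W => tens (dsusp a : Sym U) (dsusp b : Sym U)).
Proof. by move=> c x y; rewrite dsusp_lin tens_linr. Qed.
Lemma dsusp2_lin : linear dsusp2.
Proof. by apply: tlift_lin => *; [exact: dsusp2_linl|exact: dsusp2_linr]. Qed.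
Lemma dsusp2E a b : dsusp2 (tens a b) = tens (dsusp a) (dsusp b).
Proof.
by rewrite /dsusp2 tlift_tens // => *; [exact: dsusp2_linl|exact: dsusp2_linr].
Qed.

Lemma dsusp_comul v : dsusp2 (comul v) = comul (dsusp v).
Proof.
move: v; apply: sym_hext => [||q w hw].
- exact: (lin_comp (@comul_lin _ _) dsusp2_lin).
- exact: (lin_comp dsusp_lin (@comul_lin _ _)).
elim: hw => {q w} [|p q x w hx hw IH].
  rewrite dsusp_word [comul _]comul_1 dsusp2E [dsusp 1]dsusp_word.
  by rewrite [RHS]comul_1.
rewrite sword_cons comul_gen dsuspM dsusp_gen comul_gen -IH.
move: (comul (sword w)); apply: tens_ext => [||a b].
- exact: (lin_comp (@prim_mul_lin _ _ _) dsusp2_lin).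
- exact: (lin_comp dsusp2_lin (@prim_mul_lin _ _ _)).
rewrite (prim_mul_hmg _ _ hx) (linD dsusp2_lin) !dsusp2E !dsuspM dsusp_gen.
by rewrite (prim_mul_hmg _ _ ((hmg_susp2 p x).1 hx)) dsusp_twist.
Qed.

(** The double suspension respects products and coproducts, and [coder] is built from these and
    l. *)
Lemma dsusp_coder (l : Sym U -> U) v : linear l ->
  dsusp (coder (fun a => l (dsusp a) : W) v) = coder l (dsusp v).
Proof.
move=> ll; have l2 : linear (fun a => l (dsusp a) : W).
  by move=> c x y; rewrite dsusp_lin ll.
rewrite /coder -dsusp_comul; move: (comul v); apply: tens_ext => [||a b].
- exact: (lin_comp (coder_map_lin l2) dsusp_lin).
- exact: (lin_comp dsusp2_lin (coder_map_lin ll)).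
by rewrite dsusp2E !coder_mapE // dsuspM dsusp_gen.
Qed.

End Suspension.

(** * Pure BV-infinity structures and L-infinity structures *)

(** The square i, j < m is cut along the antidiagonals i + j = n; those with n >= m carry only
    zeros. *)
Lemma sum_triangle (M : nmodType) m (f : nat -> nat -> M) :
  (forall i j, (j < m)%N -> (m <= i + j)%N -> f i j = 0) ->
  \sum_(j < m) \sum_(i < m) f i j = \sum_(n < m) \sum_(i < n.+1) f i (n - i)%N.
Proof.
move=> f0; rewrite exchange_big /=.
have E (n : 'I_m) : \sum_(i < n.+1) f i (n - i)%N =
    \sum_(i < m) if (i <= n)%N then f i (n - i)%N else 0.
  by rewrite (big_ord_widen m (fun i => f i (n - i)%N)) // big_mkcond.
rewrite [RHS](eq_bigr _ (fun n _ => E n)) [RHS]exchange_big /=.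
apply: eq_bigr => i _; rewrite -big_mkcond /=.
transitivity (\sum_(0 + i <= n < m) f i (n - i)%N); last first.
  by rewrite (big_nat_widenl _ 0) ?big_mkord.
rewrite big_addn big_mkord (big_ord_widen m (fun j => f i (j + i - i)%N)) ?leq_subr //.
rewrite [RHS]big_mkcond /=; apply: eq_bigr => j _; rewrite addnK.
by case: ltnP => // ge; apply: f0 => //; lia.
Qed.

Lemma spr1_sgen (k : fieldType) (W : grspace k) (v : Sym W) : spr 1 v = sgen (spr1 v).
Proof.
move: v; apply: sym_ext => [||w].
- exact: spr_lin.
- exact: (lin_comp (@spr1_lin _ W) (@sgen_lin _ W)).
by rewrite spr_word spr1_word; case: w => [|x [|y w]] //=; rewrite sgen0.
Qed.

Section PureBV.
Variables (k : fieldType) (U : grspace k).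
Local Notation W := (susp2 U).
Local Notation gU := (galg_gr (symA U)).
Local Notation gW := (galg_gr (symA W)).

Lemma scomp_gen p (u : U) : scomp p (sgen u) = sgen (gproj U p u).
Proof.
move: u; apply: gr_ext => [||q u hu].
- exact: (lin_comp (@sgen_lin _ U) (@scomp_lin _ _ p)).
- exact: (lin_comp (@gprojP _ U p) (@sgen_lin _ U)).
have := scomp_hword p (HCons hu (HNil U)); rewrite addr0 => ->.
by rewrite (hmg_proj p hu); case: eqP => _ //; rewrite sgen0.
Qed.

(** * From a pure BV-infinity operator to brackets on U[1] *)

Section Brackets.
Variable Delta : nat -> Sym U -> Sym U.
Hypothesis pureD : is_pureBV Delta.

Let lD n : linear (Delta n.+1).
Proof. exact: (BV_lin pureD.1). Qed.

Let dD n : @gdeg k gU gU (1 - (2 * n)%:Z) (Delta n.+1).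
Proof. by move=> p v hv; rewrite addrA; apply: (BV_deg pureD.1 hv n). Qed.

Let kD n m v : (m < n.+1)%N -> Delta n.+1 (spr m v) = 0.
Proof.
move=> lt; apply: ((pureD.2 n.+1 isT).2 m) => //.
by rewrite /in_Sn sprK eqxx.
Qed.

Let gD n v : exists u, Delta n.+1 (spr n.+1 v) = sgen u.
Proof. by apply: (pureD.2 n.+1 isT).1; rewrite /in_Sn sprK eqxx. Qed.

Lemma derived_word (x : seq U) n : size x = n.+1 ->
  derived (V := symA U) Delta n.+1 [seq sgen y | y <- x] = Delta n.+1 (sword x).
Proof. by move=> sx; apply: itercomm_gens => // m v; rewrite sx; apply: kD. Qed.

Lemma Delta_word (x : seq U) n : size x = n.+1 ->
  Delta n.+1 (sword x) = sgen (spr1 (Delta n.+1 (sword x))).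
Proof.
move=> sx; have [u] := gD n (sword x); rewrite spr_word sx eqxx => ->.
by rewrite spr1_gen.
Qed.

Definition cobracket n (v : Sym U) : U := spr1 (Delta n (spr n v)).

Lemma cobracket_lin n : linear (cobracket n.+1).
Proof. exact: (lin_comp (lin_comp (@spr_lin _ _ _) (@lD n)) (@spr1_lin _ _)). Qed.

Lemma cobracket_deg n : @gdeg k gU U (1 - (2 * n)%:Z) (cobracket n.+1).
Proof.
move=> p v hv; rewrite -[p + _]addr0; apply: spr1_deg; apply: dD.
by rewrite -[p]addr0; apply: spr_deg.
Qed.

Lemma Delta_coder n : Delta n.+1 =1 coder (cobracket n.+1).
Proof.
apply: diffop_coder (@lD n) (@dD n) _ _ (@gD n).
  exact: (BV_order pureD.1).
by move=> m v; apply: kD.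
Qed.

Lemma Delta_weight n q w : hword q w -> Delta n.+1 (sword w) =
  if (n < size w)%N then spr (size w - n) (Delta n.+1 (sword w)) else 0.
Proof.
move=> hw; rewrite {1}Delta_coder.
rewrite (coder_word_weight (n := n.+1) (@cobracket_lin n) (@cobracket_deg n) _ hw).
  by rewrite -Delta_coder addn1 subSS.
by move=> v; rewrite /cobracket sprK eqxx.
Qed.

(** All brackets in one function of words. [Delta 0] is unconstrained, so the empty word is sent to
    0. *)
Definition linf_bracket (w : seq W) : W :=
  if nilp w then 0 else spr1 (Delta (size w) (sword (w : seq U))).

Lemma linf_bracket_gsym : gsymmetric linf_bracket.
Proof.
have nn (u v : seq U) x : nilp (u ++ x :: v) = false by case: u.
split=> [u v c x y|u v p q x y hx hy]; rewrite /linf_bracket !nn !size_cat /= addnS.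
  by rewrite ((sword_gsym U).1 u v) lD (@spr1_lin _ U).
rewrite ((dsusp_gsym U).2 u v _ _ _ _ hx hy).
by rewrite (linZ (@lD _)) (linZ (@spr1_lin _ U)).
Qed.

Definition linf_corestr : Sym W -> W := slift linf_bracket.
Definition linf_coder : Sym W -> Sym W := coder linf_corestr.

Lemma linf_corestr_lin : linear linf_corestr.
Proof. exact: slift_lin linf_bracket_gsym. Qed.
Lemma linf_corestr_word w : linf_corestr (sword w) = linf_bracket w.
Proof. by rewrite /linf_corestr slift_word //; apply: linf_bracket_gsym. Qed.

Lemma linf_corestr_deg : @gdeg k gW W 1 linf_corestr.
Proof.
apply: gdeg_words => [|p w hw]; first exact: linf_corestr_lin.
rewrite linf_corestr_word; case: w hw => [|x w] hw; first by rewrite /hmg gproj0.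
(* With n + 1 letters the degree in U is p + 2(n + 1) + (1 - 2n) = (p + 1) + 2, that is, p + 1 in
   U[2] for every n. *)
apply/hmg_susp2; have h := spr1_deg (@dD (size w) _ _ (hword_hmg (hword_susp2 hw))).
by apply: etrans h; congr (gproj U _ _); rewrite /=; lia.
Qed.

Lemma linf_corestr_spr n v :
  linf_corestr (spr n.+1 v) = cobracket n.+1 (dsusp v).
Proof.
move: v; apply: sym_ext => [||w].
- exact: (lin_comp (@spr_lin _ W _) linf_corestr_lin).
- exact: (lin_comp (@dsusp_lin _ U) (@cobracket_lin n)).
rewrite dsusp_word /cobracket !spr_word; case: eqP => [e|_].
  by rewrite linf_corestr_word /linf_bracket -e; case: w e.
by rewrite (lin0 linf_corestr_lin) (lin0 (@lD n)) (lin0 (@spr1_lin _ U)).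
Qed.

Lemma coder_linf_spr n v :
  coder (fun a => linf_corestr (spr n.+1 a)) v = usp (Delta n.+1 (dsusp v)).
Proof.
rewrite Delta_coder -(dsusp_coder _ (@cobracket_lin n)) dsuspK.
apply: eq_coder => [||a]; last exact: linf_corestr_spr.
- exact: (lin_comp (@spr_lin _ W _) linf_corestr_lin).
- by move=> c x y; rewrite dsusp_lin cobracket_lin.
Qed.

Lemma linf_coder_lin : linear linf_coder.
Proof. exact: coder_lin linf_corestr_lin. Qed.

(** N may exceed the weight, the further terms being zero: the square applies [linf_coder] to parts
    of different weights and uses one range for all of them. *)
Lemma linf_coder_sum m N v : (m <= N)%N -> linf_coder (spr m v) =
  \sum_(i < N) usp (Delta i.+1 (dsusp (spr m v))).
Proof.
move=> mN; move: v; apply: sym_hext => [||q w hw].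
- exact: (lin_comp (@spr_lin _ W _) linf_coder_lin).
- move=> c x y; rewrite scaler_sumr -big_split; apply: eq_bigr => i _.
  by rewrite /= spr_lin dsusp_lin lD usp_lin.
rewrite spr_word; case: eqP => [sw|_]; last first.
  rewrite (lin0 linf_coder_lin) big1 // => i _.
  by rewrite (lin0 (@dsusp_lin _ U)) (lin0 (@lD _)) (lin0 (@usp_lin _ U)).
rewrite /linf_coder (coder_sum_weights linf_corestr_lin linf_corestr_deg hw).
rewrite big_ord_recl coder0 ?add0r; last first.
  move=> v; suff: linf_corestr (spr 0 v) = 0 by [].
  move: v; apply: sym_ext => [||u].
  - exact: (lin_comp (@spr_lin _ W _) linf_corestr_lin).
  - by move=> c x y; rewrite scaler0 addr0.
  rewrite spr_word; case: eqP => [/size0nil -> |_]; last exact: (lin0 linf_corestr_lin).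
  by rewrite linf_corestr_word.
rewrite sw; under eq_bigr => i _ do rewrite coder_linf_spr.
rewrite (big_ord_widen N (fun i => usp (Delta i.+1 (dsusp (sword w))))) //.
rewrite big_mkcond; apply: eq_bigr => i _; case: ltnP => // ge.
have -> : sword w = spr m (sword w) by rewrite spr_word sw eqxx.
by rewrite dsusp_spr kD // (lin0 (@usp_lin _ U)).
Qed.

Lemma Delta_sq n v : \sum_(i < n.+1) Delta i.+1 (Delta (n - i).+1 v) = 0.
Proof.
(* The constant series v isolates one coefficient: in the inner sum only the index n - i meets v. *)
rewrite -[RHS](BV_sq pureD.1 (fun i => if i == 0%N then v else 0) n).
apply: eq_bigr => i _; congr (Delta _ _).
rewrite /bvext big_ord_recr /= subnn eqxx big1 ?add0r // => j _.
by rewrite subn_eq0 leqNgt ltn_ord (lin0 (@lD _)).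
Qed.

Lemma linf_coder_sq v : linf_coder (linf_coder v) = 0.
Proof.
have lc := linf_coder_lin.
move: v; apply: sym_hext => [||q w hw].
- exact: (lin_comp lc lc).
- by move=> c x y; rewrite scaler0 addr0.
have hU := hword_susp2 hw; pose m := size w.
have wm : sword w = spr m (sword w) by rewrite spr_word eqxx.
rewrite wm (linf_coder_sum _ (leqnn m)) -wm dsusp_word (lin_sum lc).
pose f i j := Delta i.+1 (Delta j.+1 (sword (w : seq U))).
have E (j : 'I_m) :
    linf_coder (usp (Delta j.+1 (sword (w : seq U)))) = usp (\sum_(i < m) f i j).
  rewrite (lin_sum (@usp_lin _ U)) (Delta_weight _ hU) ltn_ord.
  rewrite -[in LHS](uspK (Delta _ _)) -dsusp_spr dsuspK.
  rewrite (linf_coder_sum (N := m)) ?leq_subr //; apply: eq_bigr => i _.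
  by rewrite dsusp_spr uspK /f (Delta_weight j hU) ltn_ord sprK eqxx.
rewrite (eq_bigr _ (fun j _ => E j)) -(lin_sum (@usp_lin _ U)).
(* [Delta j.+1] lowers the weight to m - j, which [Delta i.+1] kills once i + j >= m. What is left
   splits into antidiagonals, each a coefficient of Delta^2. *)
have f0 i j : (j < m)%N -> (m <= i + j)%N -> f i j = 0.
  by move=> jm mij; rewrite /f (Delta_weight j hU) jm kD // -/m; lia.
suff -> : \sum_(j < m) \sum_(i < m) f i j =
    \sum_(n < m) \sum_(i < n.+1) f i (n - i)%N.
  by rewrite big1 => [|n _]; [exact: (lin0 (@usp_lin _ U))|exact: Delta_sq].
exact: sum_triangle.
Qed.

Lemma linf_coder_Linf : is_Linf (g := shift U 1) linf_coder.
Proof.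
have lc := linf_coder_lin.
split=> //.
- exact: (coder_deg linf_corestr_lin linf_corestr_deg).
- exists (@comul k W); first exact: shuffle_comult_comul.
  move=> v; rewrite tensder_gtensder //.
  exact: (comul_coder v linf_corestr_lin linf_corestr_deg).
- exact: linf_coder_sq.
by rewrite /linf_coder coder_1 ?[linf_corestr 1]linf_corestr_word ?sgen0 //;
   exact: linf_corestr_lin.
Qed.

Lemma linf_coder_restricts : restricts_to Delta linf_coder.
Proof.
move=> [|n] x // _ sx; rewrite derived_word // Delta_word //.
rewrite /bracket /linf_coder spr1_coder; last exact: linf_corestr_lin.
by rewrite linf_corestr_word /linf_bracket sx; case: x sx.
Qed.

Lemma derived_subspace : Linf_subspace (g := shift (symA U) 1)
  (derived (V := symA U) Delta) (fun v => exists u : U, v = sgen u).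
Proof.
split=> [|[|n] a // _ sa ga]; last first.
  have [x ax] : exists x : seq U, a = [seq sgen y | y <- x].
    elim: a ga {sa} => [|v a IH] ga; first by exists [::].
    have [u ->] : exists u : U, v = sgen u by apply: ga; rewrite inE eqxx.
    have [|x ->] := IH; last by exists (u :: x).
    by move=> z za; apply: ga; rewrite inE za orbT.
  have sx : size x = n.+1 by rewrite -sa ax size_map.
  rewrite ax; exists (spr1 (Delta n.+1 (sword x))).
  by apply: etrans (Delta_word sx); apply: derived_word.
split.
- by exists 0; rewrite sgen0.
- by move=> c _ _ [u ->] [v ->]; exists (c *: u + v); rewrite sgen_lin.
(* The subspace lies in S(U)[1], whose component of degree p is that of degree 1 + p in S(U). *)
by move=> p _ [u ->]; exists (gproj U (1 + p) u); apply: scomp_gen.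
Qed.

(** Agreement with the derived brackets fixes the brackets of D on words, so the required
    coderivation is that of [Delta_coder], read in U[2]. *)
Lemma pure_associated (D : Sym W -> Sym W) :
  restricts_to Delta D -> associated_BV (bracket D) Delta.
Proof.
move=> rD [|n] // _; exists (coder (fun a => cobracket n.+1 (dsusp a) : W)); last first.
  by move=> v; rewrite (dsusp_coder _ (@cobracket_lin n)) Delta_coder.
apply: coder_extends => [c x y|w]; first by rewrite dsusp_lin cobracket_lin.
rewrite dsusp_word /cobracket spr_word; case: eqP => [sw|_]; last first.
  by rewrite (lin0 (@lD n)) (lin0 (@spr1_lin _ U)).
by rewrite -derived_word // rD // spr1_gen.
Qed.

End Brackets.

(** * From an L-infinity structure to its BV-infinity operator *)

Section FromLinf.
Variable D : Sym W -> Sym W.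
Hypothesis linfD : is_Linf (g := shift U 1) D.

Let lD : linear D := Linf_lin linfD.

Definition bracket_corestr n (v : Sym W) : W := spr1 (D (spr n v)).

Lemma bracket_corestr_lin n : linear (bracket_corestr n).
Proof. exact: (lin_comp (lin_comp (@spr_lin _ W _) lD) (@spr1_lin _ W)). Qed.

Lemma bracket_corestr_deg n : @gdeg k gW W 1 (bracket_corestr n).
Proof.
move=> p v hv; rewrite -[p + 1]addr0; apply: spr1_deg; apply: (Linf_deg linfD).
by rewrite -[p]addr0; apply: spr_deg.
Qed.

Lemma bracket_corestr_word n w :
  bracket_corestr n (sword w) = if size w == n then bracket D w else 0.
Proof.
rewrite /bracket_corestr spr_word; case: eqP => // _.
by rewrite (lin0 lD) (lin0 (@spr1_lin _ W)).
Qed.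

Lemma coder_bracket_extends n :
  extends_bracket (bracket D) n (coder (bracket_corestr n)).
Proof.
apply: coder_extends; [exact: bracket_corestr_lin|exact: bracket_corestr_word].
Qed.

Lemma associated_exists : exists Delta, associated_BV (bracket D) Delta.
Proof.
exists (fun n v => dsusp (coder (bracket_corestr n) (usp v))) => n _.
exists (coder (bracket_corestr n)) => [|v]; last by rewrite dsuspK.
exact: coder_bracket_extends.
Qed.

(** [extends_bracket] determines its coderivation, so Delta_n is, up to suspension, [coder] of the
    n-th bracket. It kills weight below n, hence the derived bracket is its value on the word, and
    in weight n this value is the bracket. *)
Lemma associated_restricts Delta :
  associated_BV (bracket D) Delta -> restricts_to Delta D.
Proof.
move=> aD n x n0 sx; have [E hE DE] := aD n n0.
have lb := bracket_corestr_lin n; have db := @bracket_corestr_deg n.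
have lE := coder_lin lb.
have {}DE v : Delta n v = dsusp (coder (bracket_corestr n) (usp v)).
  by rewrite -(extends_bracket_uniq hE (coder_bracket_extends n)) -DE uspK.
have lDn : linear (Delta n).
  by move=> c u v; rewrite !DE usp_lin lE dsusp_lin.
have wt q w (hw : hword q w) : coder (bracket_corestr n) (sword w) =
    if (n <= size w)%N then spr (size w + 1 - n) (coder (bracket_corestr n) (sword w))
    else 0.
  by apply: (coder_word_weight lb db _ hw) => v; rewrite /bracket_corestr sprK eqxx.
have kill m (v : Sym W) : (m < n)%N -> coder (bracket_corestr n) (spr m v) = 0.
  move=> mn; move: v; apply: sym_hext => [||q w hw].
  - exact: (lin_comp (@spr_lin _ W _) lE).
  - by move=> c u v; rewrite scaler0 addr0.
  rewrite spr_word; case: eqP => [sw|_]; last exact: lin0 lE.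
  by rewrite (wt _ _ hw) sw leqNgt mn.
have top (v : Sym W) : coder (bracket_corestr n) (spr n v) =
    sgen (bracket_corestr n v).
  move: v; apply: sym_hext => [||q w hw].
  - exact: (lin_comp (@spr_lin _ W _) lE).
  - exact: (lin_comp lb (@sgen_lin _ W)).
  rewrite spr_word bracket_corestr_word; case: eqP => [sw|_]; last first.
    by rewrite (lin0 lE) sgen0.
  (* The value has weight n + 1 - n = 1, so it is the generator given by its projection [spr1]. *)
  rewrite (wt _ _ hw) sw leqnn addnC addnK spr1_sgen spr1_coder //.
  by rewrite bracket_corestr_word sw eqxx.
rewrite /derived itercomm_gens // => [|m v]; last first.
  rewrite sx DE => mn; rewrite -[v]uspK -dsusp_spr dsuspK kill //.
  exact: (lin0 (@dsusp_lin _ U)).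
rewrite DE usp_word; have -> : sword (x : seq W) = spr n (sword (x : seq W)).
  by rewrite spr_word sx eqxx.
by rewrite top dsusp_gen bracket_corestr_word sx eqxx.
Qed.

End FromLinf.
End PureBV.

Theorem theorem3p6 (k : fieldType) (hk : [pchar k] =i pred0) (U : grspace k) :
  (forall Delta : nat -> Sym U -> Sym U, is_pureBV Delta ->
    Linf_subspace (g := shift (symA U) 1) (derived (V := symA U) Delta)
      (fun v => exists u : U, v = sgen u) /\
    exists D : Sym (susp2 U) -> Sym (susp2 U),
      is_Linf (g := shift U 1) D /\ restricts_to Delta D) /\
  (forall (Delta : nat -> Sym U -> Sym U) (D : Sym (susp2 U) -> Sym (susp2 U)),
    is_pureBV Delta -> is_Linf (g := shift U 1) D -> restricts_to Delta D ->
    associated_BV (bracket D) Delta) /\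
  (forall D : Sym (susp2 U) -> Sym (susp2 U), is_Linf (g := shift U 1) D ->
    (exists Delta : nat -> Sym U -> Sym U, associated_BV (bracket D) Delta) /\
    forall Delta : nat -> Sym U -> Sym U,
      associated_BV (bracket D) Delta -> restricts_to Delta D).
Proof.
split; last split.
- move=> Delta pureD; split; first exact: derived_subspace.
  exists (linf_coder Delta); split; first exact: linf_coder_Linf.
  exact: linf_coder_restricts.
- by move=> Delta D pureD _ rD; apply: pure_associated.
move=> D linfD; split; first exact: associated_exists.
by move=> Delta; apply: associated_restricts.
Qed.
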